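(* Let $(\bar A,\bar B)$ be a structurally controllable structured system with $n$ states and $m$ inputs, where $m=O(n)$, let $p_u(j)\ge 0$, $j=1,\dots,m$, be input costs, and let $q$ be the number of non-top linked SCC's of $D(\bar A)$. Then the flow network $F(\bar A,\bar B,c)$ can be constructed in $O(n^2)$ computations. Also, if $f^\star_M$ is an optimal solution to MCFF$(q+n)$ on $F(\bar A,\bar B,c)$, then $\mathcal I_{f^\star_M}=\{j: f^\star_M((u'_j,t))>0\}$ is an optimal solution to minCCIS. Moreover, $p^\star=c^\star$.
   Context: Structured systems. A structured system is a pair $(\bar A,\bar B)$ with $\bar A\in\{0,\star\}^{n\times n}$, $\bar B\in\{0,\star\}^{n\times m}$. A numerical realization is a pair of real matrices $(A,B)$ of the same sizes with $A_{ij}=0$ whenever $\bar A_{ij}=0$ and $B_{ij}=0$ whenever $\bar B_{ij}=0$. $(\bar A,\bar B)$ is structurally controllable if some numerical realization $(A,B)$ is controllable, i.e. $\mathrm{rank}[B\ AB\ \cdots\ A^{n-1}B]=n$. For $\mathcal W\subseteq\{1,\dots,m\}$, $\bar B_{\mathcal W}$ is the restriction of $\bar B$ to the columns indexed by $\mathcal W$. minCCIS. Let $\mathcal K=\{\mathcal W\subseteq\{1,\dots,m\}:(\bar A,\bar B_{\mathcal W})\text{ is structurally controllable}\}$ and $p(\mathcal I)=\sum_{j\in\mathcal I}p_u(j)$. The minimum cost constrained input selection problem (minCCIS) asks for $\mathcal I^\star\in\arg\min_{\mathcal I\in\mathcal K}p(\mathcal I)$; $p^\star=p(\mathcal I^\star)$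 is its optimal value. State digraph and SCC's. $D(\bar A)$ has vertices $x_1,\dots,x_n$ and a directed edge $(x_j,x_i)$ iff $\bar A_{ij}\ne 0$. SCC means strongly connected component; an SCC is non-top linked if it has no incoming edges to its vertices from vertices of another SCC. Let $\mathcal N_1,\dots,\mathcal N_q$ be the non-top linked SCC's of $D(\bar A)$. Flow network $F(\bar A,\bar B,c)$. Vertex set $V_F=\{s,t\}\cup\{\mathcal N_i\}_{i=1}^q\cup\{x'_k\}_{k=1}^n\cup\{x_r\}_{r=1}^n\cup\{u_j\}_{j=1}^m\cup\{u'_j\}_{j=1}^m$ with source $s$ and sink $t$. Directed edge set $E_F$: $(s,\mathcal N_i)$ for all $i$; $(s,x'_k)$ for all $k$; $(\mathcal N_i,u'_j)$ whenever $\bar B_{rj}=\star$ for some $x_r\in\mathcal N_i$; $(x'_k,x_r)$ whenever $\bar A_{kr}\neq0$; $(x'_k,u_j)$ whenever $\bar B_{kj}\ne0$; $(u_j,u'_j)$ for all $j$; $(u'_j,t)$ for all $j$; $(x_r,t)$ for all $r$. Capacities: $b((u'_j,t))=n+1$ for all $j$, and $b(e)=1$ for every other edge. Costs: $c((u'_j,t))=p_u(j)$ for all $j$, and $c(e)=0$ for every other edge. Flows and MCFF. A flow vector is a function $f:E_F\to\mathbb R_{\ge0}$. It is feasible if $f(e)\le b(e)$ for all $e$ and, at every vertex other than $s,t$, total outgoing flow equals total incoming flow. Put $\varphi_f=\sum_{e=(s,v)\in E_F}f(e)$ and $c_f=\sum_{e:f(e)>0}c(e)$. The minimum cost fixed flow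 problem MCFF$(q+n)$ is: minimize $c_f$ over feasible flow vectors $f$ with $\varphi_f\ge q+n$. Its optimal value is $c^\star$. *)

(* Defs.v *)
From HB Require Import structures.
From mathcomp Require Import all_boot all_order all_algebra.
From mathcomp Require Import reals.

Set Implicit Arguments.
Unset Strict Implicit.
Unset Printing Implicit Defensive.

Import Order.TTheory GRing.Theory Num.Theory.
Local Open Scope ring_scope.

(** * Structured systems *)

(* A structured matrix, with entries in {0, star}, is a boolean matrix in which
   [true] stands for the symbol star. *)
Definition realizes (R : realType) (n m : nat)
    (Abar : 'M[bool]_(n, m)) (A : 'M[R]_(n, m)) : Prop :=
  forall i j, ~~ Abar i j -> A i j = 0.

(* The matrix [B, A B, ..., A^(n-1) B]. *)
Definition ctrb_mx (R : realType) (n m : nat)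
    (A : 'M[R]_n) (B : 'M[R]_(n, m)) : 'M[R]_(n, \sum_(k < n) m) :=
  \mxrow_(k < n) (A ^+ k *m B).

Definition controllable (R : realType) (n m : nat)
    (A : 'M[R]_n) (B : 'M[R]_(n, m)) : Prop :=
  \rank (ctrb_mx A B) = n.

Definition structurally_controllable (R : realType) (n m : nat)
    (Abar : 'M[bool]_n) (Bbar : 'M[bool]_(n, m)) : Prop :=
  exists (A : 'M[R]_n) (B : 'M[R]_(n, m)),
    [/\ realizes Abar A, realizes Bbar B & controllable A B].

(* The columns of [B] indexed by [W], in increasing order. *)
Definition restrict_cols (n m : nat) (B : 'M[bool]_(n, m)) (W : {set 'I_m}) :
    'M[bool]_(n, #|W|) :=
  colsub (fun k : 'I_#|W| => enum_val k) B.

(** * The minimum cost constrained input selection problem *)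

Definition input_feasible (R : realType) (n m : nat)
    (A : 'M[bool]_n) (B : 'M[bool]_(n, m)) (W : {set 'I_m}) : Prop :=
  structurally_controllable R A (restrict_cols B W).

Definition input_cost (R : realType) (m : nat) (pu : 'I_m -> R)
    (I : {set 'I_m}) : R := \sum_(j in I) pu j.

Definition minCCIS_optimal (R : realType) (n m : nat) (A : 'M[bool]_n)
    (B : 'M[bool]_(n, m)) (pu : 'I_m -> R) (I : {set 'I_m}) : Prop :=
  input_feasible R A B I /\
  forall W, input_feasible R A B W -> input_cost pu I <= input_cost pu W.

Definition minCCIS_value (R : realType) (n m : nat) (A : 'M[bool]_n)
    (B : 'M[bool]_(n, m)) (pu : 'I_m -> R) (p : R) : Prop :=
  exists2 I, minCCIS_optimal A B pu I & input_cost pu I = p.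

(** * The state digraph and its strongly connected components *)

(* The edge goes from the column index to the row index. *)
Definition state_edge (n : nat) (A : 'M[bool]_n) : rel 'I_n :=
  fun j i => A i j.

Definition scc_of (n : nat) (A : 'M[bool]_n) (x : 'I_n) : {set 'I_n} :=
  [set y | connect (state_edge A) x y && connect (state_edge A) y x].

Definition sccs (n : nat) (A : 'M[bool]_n) : {set {set 'I_n}} :=
  [set scc_of A x | x : 'I_n].

Definition non_top_linked (n : nat) (A : 'M[bool]_n) (N : {set 'I_n}) : bool :=
  [forall M in sccs A, (M != N) ==>
    [forall x in M, forall y in N, ~~ state_edge A x y]].

Definition ntl_sccs (n : nat) (A : 'M[bool]_n) : {set {set 'I_n}} :=
  [set N in sccs A | non_top_linked A N].

Definition ntl_count (n : nat) (A : 'M[bool]_n) : nat := #|ntl_sccs A|.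

Notation ntl_scc A := {N : {set 'I_ _} | N \in ntl_sccs A}.

(** * The flow network *)

(* [Xp k], [X r], [U j], [Up j] are x'_k, x_r, u_j, u'_j. *)
Inductive vertex (n m : nat) (A : 'M[bool]_n) : Type :=
| Source
| Sink
| Scc of ntl_scc A
| Xp of 'I_n
| X of 'I_n
| U of 'I_m
| Up of 'I_m.
Arguments Source {n m A}.
Arguments Sink {n m A}.
Arguments Scc {n m A}.
Arguments Xp {n m A}.
Arguments X {n m A}.
Arguments U {n m A}.
Arguments Up {n m A}.

Section VertexFinite.
Variables (n m : nat) (A : 'M[bool]_n).

Definition vertex_sum : Type :=
  (bool + (ntl_scc A + (('I_n + 'I_n) + ('I_m + 'I_m))))%type.

Definition vertex_to_sum (v : vertex m A) : vertex_sum :=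
  match v with
  | Source => inl false
  | Sink => inl true
  | Scc N => inr (inl N)
  | Xp k => inr (inr (inl (inl k)))
  | X r => inr (inr (inl (inr r)))
  | U j => inr (inr (inr (inl j)))
  | Up j => inr (inr (inr (inr j)))
  end.

Definition vertex_of_sum (s : vertex_sum) : vertex m A :=
  match s with
  | inl b => if b then Sink else Source
  | inr (inl N) => Scc N
  | inr (inr (inl (inl k))) => Xp k
  | inr (inr (inl (inr r))) => X r
  | inr (inr (inr (inl j))) => U j
  | inr (inr (inr (inr j))) => Up j
  end.

Lemma vertex_to_sumK : cancel vertex_to_sum vertex_of_sum.
Proof. by case. Qed.

HB.instance Definition _ := Finite.copy (vertex m A) (can_type vertex_to_sumK).
End VertexFinite.

Definition is_edge (n m : nat) (A : 'M[bool]_n) (B : 'M[bool]_(n, m))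
    (e : vertex m A * vertex m A) : bool :=
  match e with
  | (Source, Scc _) => true
  | (Source, Xp _) => true
  | (Scc N, Up j) => [exists r in val N, B r j]
  | (Xp k, X r) => A k r
  | (Xp k, U j) => B k j
  | (U i, Up j) => i == j
  | (Up _, Sink) => true
  | (X _, Sink) => true
  | _ => false
  end.

Notation edge A B := {e : vertex _ A * vertex _ A | is_edge B e}.

Section Network.
Variables (n m : nat) (A : 'M[bool]_n) (B : 'M[bool]_(n, m)).

Definition edge_tail (e : edge A B) : vertex m A := (val e).1.
Definition edge_head (e : edge A B) : vertex m A := (val e).2.

Definition up_edge (j : 'I_m) : edge A B := exist _ (Up j, Sink) isT.

Definition capacity (e : edge A B) : nat :=
  match val e with
  | (Up _, Sink) => n.+1
  | _ => 1%N
  end.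

Variable R : realType.

Definition edge_cost (pu : 'I_m -> R) (e : edge A B) : R :=
  match val e with
  | (Up j, Sink) => pu j
  | _ => 0
  end.

Definition feasible_flow (f : edge A B -> R) : Prop :=
  [/\ forall e, 0 <= f e,
      forall e, f e <= (capacity e)%:R
    & forall v, v != Source -> v != Sink ->
        \sum_(e | edge_tail e == v) f e = \sum_(e | edge_head e == v) f e].

Definition flow_value (f : edge A B -> R) : R := \sum_(e | edge_tail e == Source) f e.

Definition flow_cost (pu : 'I_m -> R) (f : edge A B -> R) : R :=
  \sum_(e | 0 < f e) edge_cost pu e.

Definition MCFF_feasible (d : nat) (f : edge A B -> R) : Prop :=
  feasible_flow f /\ d%:R <= flow_value f.

Definition MCFF_optimal (pu : 'I_m -> R) (d : nat) (f : edge A B -> R) : Prop :=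
  MCFF_feasible d f /\
  forall g, MCFF_feasible d g -> flow_cost pu f <= flow_cost pu g.

Definition MCFF_value (pu : 'I_m -> R) (d : nat) (c : R) : Prop :=
  exists2 f, MCFF_optimal pu d f & flow_cost pu f = c.

Definition selected_inputs (f : edge A B -> R) : {set 'I_m} :=
  [set j | 0 < f (up_edge j)].

End Network.

(** * Random access machine and running time *)

(* Natural number registers and two-dimensional arrays hold the combinatorial
   data; costs are real numbers kept in a separate memory, where they can only
   be moved or set to 0.  Arithmetic on naturals is limited to successor and
   (truncated) predecessor, so that the unit-cost measure is not distorted by
   large numbers: every number stored within T steps is at most the largest
   initial number plus O(T). *)
Inductive expr : Type :=
| Cst of nat
| Reg of nat
| Get of nat & expr & expr   (* [Get a i j] reads cell (i, j) of array a *)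
| Succ of expr
| Pred of expr
| Eq of expr & expr
| Lt of expr & expr.

Inductive cmd : Type :=
| SetReg of nat & expr
| Put of nat & expr & expr & expr   (* [Put a i j e]: cell (i, j) of a := e *)
| MoveCost of nat & expr & nat & expr
    (* [MoveCost a i b j]: cell i of cost array a := cell j of cost array b *)
| ZeroCost of nat & expr
| Seq of cmd & cmd
| If of expr & cmd & cmd
| While of expr & cmd.

Section Machine.
Variable R : realType.

Record state : Type := State {
  reg : nat -> nat;
  arr : nat -> nat -> nat -> nat;
  cst : nat -> nat -> R }.

Fixpoint eval (s : state) (e : expr) : nat :=
  match e with
  | Cst k => k
  | Reg x => reg s x
  | Get a i j => arr s a (eval s i) (eval s j)
  | Succ e => (eval s e).+1
  | Pred e => (eval s e).-1
  | Eq e1 e2 => eval s e1 == eval s e2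
  | Lt e1 e2 => (eval s e1 < eval s e2)%N
  end.

(* Evaluating an expression takes one step per operation in it. *)
Fixpoint steps (e : expr) : nat :=
  match e with
  | Cst _ | Reg _ => 1
  | Get _ i j => (steps i + steps j).+1
  | Succ e | Pred e => (steps e).+1
  | Eq e1 e2 | Lt e1 e2 => (steps e1 + steps e2).+1
  end.

Definition set_reg (s : state) (x v : nat) : state :=
  State (fun y => if y == x then v else reg s y) (arr s) (cst s).

Definition set_arr (s : state) (a i j v : nat) : state :=
  State (reg s)
    (fun a' i' j' =>
       if [&& a' == a, i' == i & j' == j] then v else arr s a' i' j')
    (cst s).

Definition set_cst (s : state) (a i : nat) (v : R) : state :=
  State (reg s) (arr s)
    (fun a' i' => if (a' == a) && (i' == i) then v else cst s a' i').

(* [exec c s t s']: started in [s], the program [c] halts in [s'] after exactly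
   [t] steps.  A test succeeds when its value is nonzero. *)
Inductive exec : cmd -> state -> nat -> state -> Prop :=
| ExecSetReg x e s :
    exec (SetReg x e) s (steps e).+1 (set_reg s x (eval s e))
| ExecPut a i j e s :
    exec (Put a i j e) s (steps i + steps j + steps e).+1
      (set_arr s a (eval s i) (eval s j) (eval s e))
| ExecMoveCost a i b j s :
    exec (MoveCost a i b j) s (steps i + steps j).+1
      (set_cst s a (eval s i) (cst s b (eval s j)))
| ExecZeroCost a i s :
    exec (ZeroCost a i) s (steps i).+1 (set_cst s a (eval s i) 0)
| ExecSeq c1 c2 s t1 s1 t2 s2 :
    exec c1 s t1 s1 -> exec c2 s1 t2 s2 -> exec (Seq c1 c2) s (t1 + t2) s2
| ExecIfTrue e c1 c2 s t s' :
    eval s e != 0%N -> exec c1 s t s' ->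
    exec (If e c1 c2) s ((steps e).+1 + t) s'
| ExecIfFalse e c1 c2 s t s' :
    eval s e = 0%N -> exec c2 s t s' ->
    exec (If e c1 c2) s ((steps e).+1 + t) s'
| ExecWhileTrue e c s t1 s1 t2 s2 :
    eval s e != 0%N -> exec c s t1 s1 -> exec (While e c) s1 t2 s2 ->
    exec (While e c) s ((steps e).+1 + t1 + t2) s2
| ExecWhileFalse e c s :
    eval s e = 0%N -> exec (While e c) s (steps e).+1 s.

(* Input: n and m in registers 0 and 1, the entries of the structured matrices
   (star is 1) in arrays 0 and 1, the input costs in cost array 0; all other
   memory is 0. *)
Definition bool_cell (n m : nat) (M : 'M[bool]_(n, m)) (i j : nat) : nat :=
  match insub i, insub j with
  | Some i', Some j' => M i' j'
  | _, _ => false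
  end.

Definition cost_cell (m : nat) (pu : 'I_m -> R) (j : nat) : R :=
  if insub j is Some j' then pu j' else 0.

Definition input_state (n m : nat) (A : 'M[bool]_n) (B : 'M[bool]_(n, m))
    (pu : 'I_m -> R) : state :=
  State
    (fun x => match x with 0 => n | 1 => m | _ => 0 end)%N
    (fun a i j => match a with
       0 => bool_cell A i j | 1 => bool_cell B i j | _ => 0 end)%N
    (fun a j => if a == 0%N then cost_cell pu j else 0).

(* A vertex is written as a kind and an index in its kind; [num] numbers the
   non-top linked SCC's. *)
Definition vertex_code (n m : nat) (A : 'M[bool]_n)
    (num : ntl_scc A -> 'I_(ntl_count A)) (v : vertex m A) : nat * nat :=
  match v with
  | Source => (0, 0)
  | Sink => (1, 0)
  | Scc N => (2, num N : nat)
  | Xp k => (3, k : nat)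
  | X r => (4, r : nat)
  | U j => (5, j : nat)
  | Up j => (6, j : nat)
  end%N.

(* Output, for some numbering of the non-top linked SCC's chosen by the program:
   - register 2 holds q; cell (0, r) of array 2 holds 1 + the number of the
     non-top linked SCC containing x_r, or 0 if there is none;
   - row k of array 3, for k less than register 3, lists the vertices;
   - row k of array 4, together with cell k of cost array 1, for k less than
     register 4, lists the edges with their tails, heads, capacities and costs.
   [perm_eq] imposes that every vertex and every edge be listed exactly once. *)
Definition outputs_network (n m : nat) (A : 'M[bool]_n) (B : 'M[bool]_(n, m))
    (pu : 'I_m -> R) (s : state) : Prop :=
  exists num : ntl_scc A -> 'I_(ntl_count A),
    [/\ bijective num,
        reg s 2 = ntl_count A,
        forall r : 'I_n,
          (forall N : ntl_scc A, r \in val N -> arr s 2 0 r = (num N).+1) /\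
          ((forall N : ntl_scc A, r \notin val N) -> arr s 2 0 r = 0%N),
        perm_eq [seq (arr s 3 k 0, arr s 3 k 1) | k <- iota 0 (reg s 3)]
                [seq vertex_code num v | v : vertex m A]
      & perm_eq [seq ((arr s 4 k 0, arr s 4 k 1), (arr s 4 k 2, arr s 4 k 3),
                      arr s 4 k 4, cst s 1 k) | k <- iota 0 (reg s 4)]
                [seq (vertex_code num (edge_tail e), vertex_code num (edge_head e),
                      capacity e, edge_cost pu e) | e : edge A B]].

End Machine.

(* A single program, independent of the system, builds the network; since
   m = O(n), the constant in the running time may depend on the bound K
   of m / n. *)
Definition network_constructible_quadratic (R : realType) : Prop :=
  exists P : cmd, forall K : nat, exists C : nat,
    forall (n m : nat) (A : 'M[bool]_n) (B : 'M[bool]_(n, m)) (pu : 'I_m -> R),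
      (0 < n)%N -> (m <= K * n)%N ->
      structurally_controllable R A B -> (forall j, 0 <= pu j) ->
      exists (t : nat) (s : state R),
        [/\ exec P (input_state A B pu) t s, (t <= C * n ^ 2)%N
          & outputs_network A B pu s].

(* Main.v *)
Require Import Defs.
From HB Require Import structures.
From mathcomp Require Import all_boot all_order all_fingroup all_algebra.
From mathcomp Require Import boolp reals.
From mathcomp Require Import ring lra zify.

Set Implicit Arguments.
Unset Strict Implicit.
Unset Printing Implicit Defensive.

Import Order.TTheory GRing.Theory Num.Theory.
Local Open Scope ring_scope.

(** The two claims have separate proofs.

    Optimality.  By Lin's theorem ([input_feasibleP]) a set [W] of inputs makes the
    system structurally controllable exactly when every non-top linked component
    is entered by an input of [W] and the rows can be matched injectively to
    states and inputs of [W].  A flow of value [q + n] encodes precisely these two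
    facts, because it saturates all edges at the source: the unit that reaches a
    component must leave through an input entering it, and the units that reach
    the vertices [Xp k] form a fractional matching, from which Hall's theorem
    ([hall], [fractional_matching]) extracts a matching in the same support.
    Conversely a component hit and a matching give an integral flow.  The cost of
    a flow is the cost of the inputs it uses, so both minima agree
    ([MCFF_minCCIS]).

    Lin's theorem itself is proved without eigenvalues.  Necessity: a component
    without inputs stays at rest, and a controllable pair has a matrix [A B] of
    full row rank, hence a nonzero Leibniz term.  Sufficiency: the matching
    splits the states into paths issued from inputs, which are shift registers
    ([stems_controllable]), and cycles.  Accessibility allows the cycles to be
    attached one at a time; when the part already built is scaled down enough, the
    enlarged part is again controllable ([attach_cycle]).

    Construction.  Only the non-top linked components have to be found, and three
    graph searches over the adjacency matrix suffice.  A search over all vertices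
    keeps the vertices that no earlier kept vertex reaches; the same search over
    the kept vertices, in reverse order, leaves exactly one vertex in each
    non-top linked component ([two_searches]); a search along reversed edges from
    these labels the components.  Each search makes at most [2n] rounds of linear
    cost ([search_runs]).  Nested loops then list the vertices and edges
    ([build_network_runs]).  Running times are tracked by triples [runs], in
    which a loop pays for its rounds with a decreasing potential, and memory that
    a program does not mention is framed by reading its text ([exec_same]). *)

(** * Controllability of realizations *)

Section Controllability.
Variable R : realType.

Lemma krylov_vanish n m (A : 'M[R]_n) (B : 'M[R]_(n, m)) (v : 'rV_n) :
  (forall k, (k < n)%N -> v *m A ^+ k *m B = 0) ->
  forall k, v *m A ^+ k *m B = 0.
Proof.
case: n A B v => [|n] A B v H.
  by move=> k; rewrite (thinmx0 v) !mul0mx.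
(* The characteristic polynomial rewrites a power of exponent at least the
   dimension in terms of smaller powers. *)
have CH : A ^+ n.+1 = - \sum_(i < n.+1) (char_poly A)`_i *: A ^+ i.
  have := Cayley_Hamilton A.
  rewrite /horner_mx /horner_morph horner_coef size_map_poly size_char_poly big_ord_recr /=.
  have /monicP := char_poly_monic A; rewrite /lead_coef size_char_poly /= => lc.
  rewrite coef_map lc /= rmorph1 mul1r addrC => /eqP; rewrite addr_eq0 => /eqP ->.
  congr (- _); apply: eq_bigr => i _.
  by rewrite coef_map /= -mulmxE mul_scalar_mx.
elim/ltn_ind=> k IH; have [|le_nk] := ltnP k n.+1; first exact: H.
rewrite -(subnK le_nk) exprD CH mulrN mulmxN mulNmx; apply/eqP.
rewrite oppr_eq0 mulr_sumr mulmx_sumr mulmx_suml big1 // => i _.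
rewrite -scalerAr -exprD -scalemxAr -scalemxAl IH ?scaler0 //.
by have := ltn_ord i; lia.
Qed.

Lemma controllableP n m (A : 'M[R]_n) (B : 'M[R]_(n, m)) :
  controllable A B <->
  forall v : 'rV_n, (forall k, v *m A ^+ k *m B = 0) -> v = 0.
Proof.
have mulE (v : 'rV_n) : (v *m ctrb_mx A B = 0) <->
    (forall k, (k < n)%N -> v *m A ^+ k *m B = 0).
  rewrite mul_mxrow -[RHS]mxrow0; split=> [/eq_mxrowP h k kn|h].
    by rewrite -mulmxA; have := h (Ordinal kn).
  by apply/eq_mxrowP => k; rewrite mulmxA h.
split=> [/eqP rk v h|h].
  apply/eqP; rewrite -(mulmx_free_eq0 v rk); apply/eqP/mulE => k _; exact: h.
apply/eqP; apply: inj_row_free => v /mulE hv; apply: h.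
exact: krylov_vanish.
Qed.

Lemma controllable_row_free n m (A : 'M[R]_n) (B : 'M[R]_(n, m)) :
  controllable A B -> row_free (row_mx A B).
Proof.
move=> /controllableP h; apply: inj_row_free => v.
rewrite mul_mx_row -row_mx0 => /eq_row_mx[vA vB]; apply: h => -[|k].
  by rewrite expr0 mulmx1.
by rewrite exprS -mulmxE mulmxA vA !mul0mx.
Qed.

(** A nonzero maximal minor has a nonzero term in its Leibniz expansion. *)
Lemma row_free_matching n p (M : 'M[R]_(n, p)) : row_free M ->
  exists2 f : 'I_n -> 'I_p, injective f & forall i, M i (f i) != 0.
Proof.
rewrite /row_free -mxrank_tr => rf0; have rf : row_full M^T := rf0.
have := fullrowsub_unit rf; rewrite unitmxE unitfE => nz.
have [s hs] : exists s : 'S_n, \prod_i rowsub (fullrankfun rf) M^T i (s i) != 0.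
  apply/existsP; apply: contraNT nz; rewrite negb_exists => /forallP h.
  rewrite /determinant big1 // => s _.
  by have := h s; rewrite negbK => /eqP ->; rewrite mulr0.
exists (fun i => fullrankfun rf ((s^-1)%g i)).
  by move=> i j /fullrankfun_inj/perm_inj.
move=> i; move/prodf_neq0: hs => /(_ ((s^-1)%g i) isT).
by rewrite !mxE permKV.
Qed.

(** ** Attaching a cycle to a controllable part *)

Definition controllable_on n m (S : {set 'I_n}) (A : 'M[R]_n)
    (B : 'M[R]_(n, m)) : Prop :=
  forall v : 'rV_n, (forall k, v *m A ^+ k *m B = 0) ->
  forall x, x \in S -> v 0 x = 0.

Definition rows_in n p (S : {set 'I_n}) (M : 'M[R]_(n, p)) : Prop :=
  forall i j, M i j != 0 -> i \in S.

Definition cycle_mx n (sigma : 'S_n) (C : {set 'I_n}) : 'M[R]_n :=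
  \matrix_(i, j) ((j \in C) && (i == sigma j))%:R.

Lemma mul_rows_in n p (S : {set 'I_n}) (M : 'M[R]_(n, p)) (u w : 'rV_n) :
  rows_in S M -> (forall x, x \in S -> u 0 x = w 0 x) -> u *m M = w *m M.
Proof.
move=> SM uw; apply/rowP => j; rewrite !mxE; apply: eq_bigr => x _.
have [->|/SM xS] := eqVneq (M x j) 0; first by rewrite !mulr0.
by rewrite uw.
Qed.

Lemma rows_in_mul n m (S : {set 'I_n}) (A : 'M[R]_n) (B : 'M[R]_(n, m)) r :
  rows_in S A -> rows_in S B -> rows_in S (A ^+ r *m B).
Proof.
case: r => [|r] SA SB; first by rewrite expr0 mul1mx.
rewrite exprS -mulmxE -mulmxA => i j; rewrite mxE => nz.
apply/negPn/negP => iS; case/eqP: nz; apply: big1 => k _.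
by have [->|/SA] := eqVneq (A i k) 0; rewrite ?mul0r // (negPf iS).
Qed.

(** Let [u] be the orbit of a left vector that no input sees, in a system where
    the vertex [l] feeds the old part through the row [a] and the inputs through
    the row [b].  Comparing the outputs at the first time when the signal of [l]
    can reach an input bounds this signal by [eps] times the old part of [u]. *)
Lemma entry_signal n m (S : {set 'I_n}) (A : 'M[R]_n) (B : 'M[R]_(n, m))
    (l : 'I_n) (a : 'rV_n) (b : 'rV_m) :
  controllable_on S A B -> rows_in S A -> rows_in S B ->
  rows_in S a^T -> (a != 0) || (b != 0) ->
  exists (G : 'M[R]_(n, m)) (j : 'I_m) (g : R),
    [/\ rows_in S G, g != 0 &
      forall eps (u : nat -> 'rV_n), eps != 0 ->
        (forall t x, x \in S ->
           u t.+1 0 x = eps * (u t *m A) 0 x + u t 0 l * a 0 x) ->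
        (forall t, eps *: (u t *m B) + u t 0 l *: b = 0) ->
        forall t, u t 0 l * g = - eps * (u t *m G) 0 j].
Proof.
move=> ctrl SA SB Sa ab0.
have [b0|/rV0Pn[j bj]] := eqVneq b 0; last first.
  exists B, j, (b 0 j); split=> // eps u _ _ hB t.
  have /rowP/(_ j) := hB t; rewrite !mxE => /eqP.
  by rewrite addrC addr_eq0 mulNr => /eqP.
have {ab0} a0 : a != 0 by move: ab0; rewrite b0 eqxx orbF.
have exd : exists d, a *m A ^+ d *m B != 0.
  have [y ay] := rV0Pn _ a0.
  have yS : y \in S by apply: (Sa y 0); rewrite mxE.
  have [/existsP[d hd]|] := boolP [exists d : 'I_n, a *m A ^+ d *m B != 0].
    by exists d.
  rewrite negb_exists => /forallP h; case/eqP: ay; apply: ctrl yS.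
  apply: krylov_vanish => k kn.
  by have := h (Ordinal kn); rewrite negbK => /eqP.
case: (ex_minnP exd) => d dnz dmin.
have [j gj] := rV0Pn _ dnz.
exists (A ^+ d.+1 *m B), j, ((a *m A ^+ d *m B) 0 j); split=> //.
  exact: rows_in_mul.
move=> eps u eps0 uS uB.
have step r t : u t.+1 *m (A ^+ r *m B) =
    eps *: (u t *m (A ^+ r.+1 *m B)) + u t 0 l *: (a *m (A ^+ r *m B)).
  rewrite exprS -mulmxE -(mulmxA A) (mulmxA (u t)).
  rewrite (scalemxAl _ (u t *m A)) (scalemxAl _ a) -mulmxDl.
  apply: mul_rows_in; first exact: rows_in_mul SA SB.
  by move=> x xS; rewrite uS // !mxE.
have silent r : (r <= d)%N -> forall t, u t *m (A ^+ r *m B) = 0.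
  elim: r => [|r IH] rd t.
    have := uB t; rewrite b0 scaler0 addr0 expr0 mul1mx => /eqP.
    by rewrite scaler_eq0 (negPf eps0) => /eqP.
  have := step r t; rewrite IH ?(ltnW rd) //.
  suff -> : a *m (A ^+ r *m B) = 0.
    rewrite scaler0 addr0 => /esym/eqP; rewrite scaler_eq0 (negPf eps0).
    by move/eqP.
  apply/eqP; rewrite mulmxA; apply: contraTT rd => /dmin.
  by rewrite -leqNgt.
move=> t; rewrite -[a *m A ^+ d *m B]mulmxA; move: (step d t); rewrite silent //.
move: (u t *m _) (a *m _) => X g /rowP/(_ j); rewrite !mxE => /esym/eqP.
by rewrite addrC addr_eq0 mulNr => /eqP.
Qed.

(** A cycle of weight one that is fed by the old part, or by an input, is
    controllable together with the old part as soon as the old weights are small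
    enough: an unseen left vector [v] is periodic along the cycle, and over one
    period the norm of its old part is at most a constant times the norm of the
    entry signal, which is itself at most [eps] times a constant times the norm
    of the old part. *)
Lemma attach_cycle n m (S : {set 'I_n}) (A : 'M[R]_n) (B : 'M[R]_(n, m))
    (sigma : 'S_n) (l : 'I_n) (a : 'rV_n) (b : 'rV_m)
    (C := porbit sigma l) :
  controllable_on S A B -> rows_in S A -> rows_in S A^T -> rows_in S B ->
  rows_in S a^T -> (a != 0) || (b != 0) -> [disjoint S & C] ->
  exists eps, controllable_on (S :|: C)
    (eps *: A + cycle_mx sigma C + delta_mx l 0 *m a)
    (eps *: B + delta_mx l 0 *m b).
Proof.
move=> ctrl SA SAT SB Sa ab0 SC.
have [G [j [g [SG g0 entry]]]] := entry_signal l ctrl SA SB Sa ab0.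
pose alpha := \sum_(x in S) `|a 0 x|.
pose nG := \sum_(x in S) `|G x j|.
pose nA := \sum_(x in S) \sum_(y in S) `|A y x|.
have al0 : 0 <= alpha by apply: sumr_ge0.
have nG0 : 0 <= nG by apply: sumr_ge0.
have nA0 : 0 <= nA by apply: sumr_ge0 => x _; apply: sumr_ge0.
have g_gt0 : 0 < `|g| by rewrite normr_gt0.
(* The final estimate bounds the old part by [eps * (nA |g| + alpha nG) / |g|]
   times itself; the summand 1 keeps the denominator positive. *)
pose den := nA * `|g| + alpha * nG + 1.
have den_gt0 : 0 < den by rewrite ltr_wpDl // addr_ge0 // mulr_ge0 // ltW.
pose eps := `|g| / den.
have eps_gt0 : 0 < eps by rewrite divr_gt0.
have eps_small : eps * (nA * `|g| + alpha * nG) < `|g|.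
  rewrite /eps mulrAC -mulrA gtr_pMr // ltr_pdivrMr // mul1r /den.
  by rewrite ltrDl.
clearbody eps; exists eps => v; set A' := _ + _ + _; set B' := _ + _ => unseen.
have notC x : x \in S -> x \in C = false.
  by move=> xS; apply: disjointFr SC xS.
have notS x : x \in C -> x \in S = false.
  by move=> xC; apply: disjointFl SC xC.
have lC : l \in C by apply: porbit_id.
have mul_l p (u : 'rV[R]_n) (c : 'rV[R]_p) : u *m (delta_mx l 0 *m c) = u 0 l *: c.
  rewrite mulmxA; apply/rowP => k; rewrite !mxE big_ord1 !mxE.
  rewrite (bigD1 l) //= big1 ?addr0 ?mxE ?eqxx ?mulr1 // => i il.
  by rewrite mxE (negPf il) mulr0.
have mul_cyc (u : 'rV[R]_n) x : (u *m cycle_mx sigma C) 0 x = u 0 (sigma x) *+ (x \in C).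
  rewrite mxE (bigD1 (sigma x)) //= big1 ?addr0 => [|i ix].
    by rewrite mxE eqxx andbT mulr_natr.
  by rewrite mxE (negPf ix) andbF mulr0.
have aS x : x \in C -> a 0 x = 0.
  move=> xC; apply/eqP/negPn/negP => nz.
  by have := Sa x 0; rewrite mxE nz notS // => /(_ isT).
have AS (u : 'rV[R]_n) x : x \in C -> (u *m A) 0 x = 0.
  move=> xC; rewrite mxE big1 // => i _; have [->|nz] := eqVneq (A i x) 0.
    by rewrite mulr0.
  by have := SAT x i; rewrite mxE nz notS // => /(_ isT).
have onC (u : 'rV[R]_n) x : x \in C -> (u *m A') 0 x = u 0 (sigma x).
  move=> xC; rewrite /A' !mulmxDr -scalemxAr mul_l 2!mxE mul_cyc xC.
  by rewrite mxE AS // mulr0 add0r mxE aS // mulr0 addr0.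
have onS (u : 'rV[R]_n) x : x \in S ->
    (u *m A') 0 x = eps * (u *m A) 0 x + u 0 l * a 0 x.
  move=> xS; rewrite /A' !mulmxDr -scalemxAr mul_l 2!mxE mul_cyc notC //.
  by rewrite mulr0n addr0 [X in X + _]mxE [X in _ + X]mxE.
pose u t := v *m A' ^+ t.
have uS t : u t.+1 = u t *m A' by rewrite /u exprSr -mulmxE mulmxA.
have uB t : u t *m B' = 0 by apply: unseen.
have onB (w : 'rV[R]_n) : w *m B' = eps *: (w *m B) + w 0 l *: b.
  by rewrite /B' mulmxDr -scalemxAr mul_l.
pose k := #[sigma]%g.
have k0 : (0 < k)%N by apply: order_gt0.
have sC x : x \in C -> sigma x \in C.
  by case/porbitP=> i ->; rewrite -permM -expgSr mem_porbit.
have u_cycle t x : x \in C -> u t 0 x = v 0 ((sigma ^+ t)%g x).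
  elim: t x => [|t IH] x xC; first by rewrite /u expr0 mulmx1 expg0 perm1.
  by rewrite uS onC // IH ?sC // expgS permM.
(* An unseen vector that vanishes on the cycle stays there, hence it is unseen
   in the old system as well. *)
have period x : x \in S -> u k 0 x = v 0 x.
  have subE (p q : 'rV[R]_n) y : (p - q) 0 y = p 0 y - q 0 y by rewrite !mxE.
  pose w t := (u k - v) *m A' ^+ t.
  have wS t : w t.+1 = w t *m A' by rewrite /w exprSr -mulmxE mulmxA.
  have wC t y : y \in C -> w t 0 y = 0.
    elim: t y => [|t IH] y yC; last by rewrite wS onC // IH ?sC.
    by rewrite /w expr0 mulmx1 subE u_cycle // expg_order perm1 addrN.
  have wB t : w t *m B' = 0.
    rewrite /w !mulmxBl unseen subr0 /u.
    by rewrite -(mulmxA v) mulmxE -exprD unseen.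
  have wAB r : forall t, w t *m (A ^+ r *m B) = 0.
    elim: r => [|r IH] t.
      have := wB t; rewrite onB wC // scale0r addr0 expr0 mul1mx => /eqP.
      by rewrite scaler_eq0 gt_eqF // => /eqP.
    have := IH t.+1; rewrite (@mul_rows_in _ _ S _ _ (eps *: (w t *m A))).
    - rewrite -scalemxAl exprS -mulmxE !mulmxA => /eqP.
      by rewrite scaler_eq0 gt_eqF // => /eqP.
    - exact: rows_in_mul SA SB.
    - by move=> y yS; rewrite wS onS // wC // mul0r addr0 !mxE.
  move=> xS; have w0 : w 0 = u k - v by rewrite /w expr0 mulmx1.
  have : (u k - v) 0 x = 0.
    by apply: ctrl xS => r; rewrite -w0 -mulmxA wAB.
  by rewrite subE => /eqP; rewrite subr_eq0 => /eqP.
pose Y t := \sum_(x in S) `|u t 0 x|.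
have Y0 t : 0 <= Y t by apply: sumr_ge0.
have le_c t : `|u t 0 l| * `|g| <= eps * (nG * Y t).
  rewrite -normrM (entry eps u) ?gt_eqF //; first last.
  - by move=> t'; rewrite -onB.
  - by move=> t' x xS; rewrite uS onS.
  rewrite normrM normrN (gtr0_norm eps_gt0) ler_pM2l // mxE.
  apply: le_trans (ler_norm_sum _ _ _) _.
  rewrite (bigID (mem S)) /= [X in _ + X]big1 ?addr0; last first.
    move=> x xS; have [->|/SG] := eqVneq (G x j) 0; first by rewrite mulr0 normr0.
    by rewrite (negPf xS).
  rewrite mulrC /Y mulr_suml; apply: ler_sum => x xS; rewrite normrM.
  rewrite ler_wpM2l // /nG (bigD1 x) //= lerDl; exact: sumr_ge0.
have le_Y t : Y t.+1 <= eps * (nA * Y t) + `|u t 0 l| * alpha.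
  rewrite /nA mulr_suml /alpha !mulr_sumr -big_split /= {1}/Y.
  apply: ler_sum => x xS; rewrite uS onS //.
  apply: le_trans (ler_normD _ _) _; rewrite !normrM lerD2r (gtr0_norm eps_gt0).
  rewrite ler_pM2l // mxE; apply: le_trans (ler_norm_sum _ _ _) _.
  rewrite (bigID (mem S)) /= [X in _ + X]big1 ?addr0; last first.
    move=> y yS; have [->|/SA] := eqVneq (A y x) 0; first by rewrite mulr0 normr0.
    by rewrite (negPf yS).
  rewrite mulr_suml; apply: ler_sum => y yS; rewrite normrM mulrC.
  rewrite ler_wpM2l // /Y (bigD1 y) //= lerDl; exact: sumr_ge0.
pose sY := \sum_(t < k) Y t; pose sc := \sum_(t < k) `|u t 0 l|.
have sY0 : 0 <= sY by apply: sumr_ge0.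
have sc0 : 0 <= sc by apply: sumr_ge0.
have sum_c : sc * `|g| <= eps * (nG * sY).
  by rewrite /sc /sY mulr_suml !mulr_sumr; apply: ler_sum.
have shift : \sum_(t < k) Y t.+1 = sY.
  rewrite /sY -(prednK k0) big_ord_recr [RHS]big_ord_recl /= addrC.
  congr (_ + _); rewrite prednK // /Y; apply: eq_bigr => x xS.
  by rewrite period // /u expr0 mulmx1.
have sum_Y : sY <= eps * (nA * sY) + sc * alpha.
  rewrite -{1}shift; apply: le_trans (_ : \sum_(t < k)
    (eps * (nA * Y t) + `|u t 0 l| * alpha) <= _); first exact: ler_sum.
  by rewrite big_split /= -!mulr_sumr -mulr_suml.
have {}sY0 : sY = 0.
  apply/eqP; rewrite eq_le sY0 andbT leNgt; apply/negP => sY_gt0.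
  have : sY * `|g| <= sY * (eps * (nA * `|g| + alpha * nG)).
    have : sY * `|g| <= eps * (nA * sY) * `|g| + alpha * (sc * `|g|).
      apply: le_trans (ler_wpM2r (ltW g_gt0) sum_Y) _.
      by rewrite mulrDl lerD2l mulrAC mulrC.
    move/le_trans; apply.
    apply: le_trans (lerD (lexx _) (ler_wpM2l al0 sum_c)) _.
    by rewrite le_eqVlt; apply/orP; left; apply/eqP; ring.
  by rewrite ler_pM2l // leNgt eps_small.
have {}sc0 : sc = 0.
  apply/eqP; rewrite eq_le sc0 andbT -(pmulr_lle0 _ g_gt0).
  by move: sum_c; rewrite sY0 !mulr0.
move=> x; rewrite inE => /orP[xS|/porbitPmin[i ik ->]].
  have /eqP := sY0; rewrite psumr_eq0 // => /allP/(_ (Ordinal k0)).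
  rewrite mem_index_enum => /(_ isT); rewrite psumr_eq0 // => /allP/(_ x).
  by rewrite mem_index_enum xS normr_eq0 /u expr0 mulmx1 => /(_ isT)/eqP.
have /eqP := sc0; rewrite psumr_eq0 // => /allP/(_ (Ordinal ik)).
rewrite mem_index_enum => /(_ isT); rewrite normr_eq0 u_cycle //.
by move/eqP.
Qed.

(** ** Lin's theorem *)

Definition matching_edge n m (A : 'M[bool]_n) (B : 'M[bool]_(n, m)) (k : 'I_n)
    (c : 'I_n + 'I_m) : bool :=
  match c with inl r => A k r | inr j => B k j end.

Definition matched n m (A : 'M[bool]_n) (B : 'M[bool]_(n, m)) : Prop :=
  exists2 phi : 'I_n -> 'I_n + 'I_m,
    injective phi & forall k, matching_edge A B k (phi k).

Definition accessible n m (A : 'M[bool]_n) (B : 'M[bool]_(n, m)) : Prop :=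
  forall x, exists y j, B y j && connect (state_edge A) y x.

(** The matrices keep their full size and vanish outside [S], so that enlarging
    [S] changes no dimension. *)
Definition controllable_part n m (A : 'M[bool]_n) (B : 'M[bool]_(n, m))
    (S : {set 'I_n}) : Prop :=
  exists (A0 : 'M[R]_n) (B0 : 'M[R]_(n, m)),
    [/\ realizes A A0, realizes B B0,
        [/\ rows_in S A0, rows_in S A0^T & rows_in S B0]
      & controllable_on S A0 B0].

(** The vertices that the matching links to an input form disjoint paths, each
    issued from its own input; with unit weights these paths are shift registers,
    so every vertex of a path is seen after as many steps as its distance. *)
Lemma stems_controllable n m (A : 'M[bool]_n) (B : 'M[bool]_(n, m))
    (phi : 'I_n -> 'I_n + 'I_m) :
  injective phi -> (forall k, matching_edge A B k (phi k)) ->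
  exists2 S : {set 'I_n}, (forall k, k \notin S -> exists2 r, phi k = inl r & r \notin S)
           & controllable_part A B S.
Proof.
move=> phi_inj phiE; pose e : rel 'I_n := fun x y => phi x == inl y.
pose S := [set x | [exists y, exists j, connect e x y && (phi y == inr j)]].
have SI x y j : connect e x y -> phi y = inr j -> x \in S.
  move=> xy yj; rewrite inE; apply/existsP; exists y; apply/existsP; exists j.
  by rewrite xy yj eqxx.
have S_step k r : phi k = inl r -> r \in S -> k \in S.
  move=> kr; rewrite inE => /existsP[y /existsP[j /andP[ry /eqP yj]]].
  apply: SI yj; apply: connect_trans ry; apply: connect1.
  by rewrite /e kr.
exists S => [k kS|].
  case phik: (phi k) => [r|j]; last by rewrite (SI k k j) in kS.
  by exists r => //; apply: contra kS; apply: S_step.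
pose A0 : 'M[R]_n := \matrix_(k, r) ((phi k == inl r) && (r \in S))%:R.
pose B0 : 'M[R]_(n, m) := \matrix_(k, j) (phi k == inr j)%:R.
exists A0, B0; split.
- move=> k r Akr; rewrite mxE; case: eqP => //= kr.
  by have := phiE k; rewrite kr /= (negPf Akr).
- move=> k j Bkj; rewrite mxE; case: eqP => //= kr.
  by have := phiE k; rewrite kr /= (negPf Bkj).
- split=> k r; rewrite !mxE pnatr_eq0 eqb0 negbK.
  + by case/andP=> /eqP; apply: S_step.
  + by case/andP.
  + by move/eqP => kr; apply: SI kr; apply: connect0.
move=> v unseen x; rewrite inE => /existsP[y /existsP[j /andP[/connectP[p xp ->]]]].
move/eqP => yj.
suff shift : (v *m A0 ^+ size p *m B0) 0 j = v 0 x by rewrite -shift unseen mxE.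
elim: p x v xp yj {unseen y} => [|z p IH] x v /=.
  move=> _ xj; rewrite expr0 mulmx1 mxE (bigD1 x) //= mxE xj eqxx mulr1.
  rewrite big1 ?addr0 // => k kx; rewrite mxE -xj (inj_eq phi_inj) (negPf kx).
  by rewrite mulr0.
case/andP=> /eqP xz zp yj; rewrite exprS -mulmxE mulmxA (IH z) //.
have zS : z \in S by apply: SI yj; apply/connectP; exists p.
rewrite mxE (bigD1 x) //= mxE xz eqxx zS mulr1.
rewrite big1 ?addr0 // => k kx; rewrite mxE -xz (inj_eq phi_inj) (negPf kx).
by rewrite mulr0.
Qed.

(** Accessibility provides an edge into a cycle of the matching that is not yet
    attached. *)
Lemma accessible_entry n m (A : 'M[bool]_n) (B : 'M[bool]_(n, m))
    (S : {set 'I_n}) : accessible A B -> S != setT ->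
  exists2 l, l \notin S &
    (exists2 i, i \in S & A l i) \/ (exists j, B l j).
Proof.
move=> acc ST.
have [x xS] : exists x, x \notin S.
  apply/existsP; apply: contraNT ST; rewrite negb_exists => /forallP h.
  by apply/eqP/setP => x; have := h x; rewrite negbK inE.
have [y [j /andP[yj /connectP[p yp xE]]]] := acc x.
have [yS|yS] := boolP (y \in S); last by exists y => //; right; exists j.
subst x; elim: p y yS yp xS {yj} => [|z p IH] y yS /=; first by rewrite yS.
case/andP=> yz zp xS; have [zS|zS] := boolP (z \in S); first exact: IH zp xS.
by exists z => //; left; exists y.
Qed.

Lemma controllable_part_grow n m (A : 'M[bool]_n) (B : 'M[bool]_(n, m))
    (phi : 'I_n -> 'I_n + 'I_m) (S : {set 'I_n}) (l : 'I_n) :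
  injective phi -> (forall k, matching_edge A B k (phi k)) ->
  (forall k, k \notin S -> exists2 r, phi k = inl r & r \notin S) ->
  controllable_part A B S -> l \notin S ->
  (exists2 i, i \in S & A l i) \/ (exists j, B l j) ->
  exists S' : {set 'I_n},
    [/\ S \proper S',
        forall k, k \notin S' -> exists2 r, phi k = inl r & r \notin S'
      & controllable_part A B S'].
Proof.
move=> phi_inj phiE Scl [A0 [B0 [rA rB [SA SAT SB] ctrl]]] lS entry.
pose f k := if k \in S then k else if phi k is inl r then r else k.
have fS k : (f k \in S) = (k \in S).
  rewrite /f; case: (boolP (k \in S)) => // /[dup] kS /Scl[r -> rS].
  exact: negPf.
have f_inj : injective f.
  move=> x y xy; have := fS x; rewrite xy fS => yxS; move: xy.
  rewrite /f yxS; case: (boolP (x \in S)) => [//|xS].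
  have [rx ex _] := Scl _ xS.
  have [|ry ey _] := Scl y; first by rewrite yxS.
  by rewrite ex ey => rxy; apply: phi_inj; rewrite ex ey rxy.
(* The matching goes from the head of an edge to its tail, whereas the signal
   runs along the edges, hence the inverse. *)
pose sigma := (perm f_inj)^-1%g; pose C := porbit sigma l.
have mem_f k : (f k \in C) = (k \in C).
  rewrite /C porbitV 2!(porbit_sym _ _ l) -(porbit_perm (perm f_inj) 1 k).
  by rewrite expg1 permE.
have CS x : x \in C -> x \notin S.
  rewrite /C porbitV => /porbitP[i ->]; elim: i => [|i IH].
    by rewrite expg0 perm1.
  by rewrite expgSr permM permE fS.
have SC : [disjoint S & C].
  by rewrite disjoint_sym disjoint_subset; apply/subsetP => x /CS.
have lC : l \in C by apply: porbit_id.
have [a [b [Sa ab0 aA bB]]] : exists (a : 'rV[R]_n) (b : 'rV[R]_m),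
    [/\ rows_in S a^T, (a != 0) || (b != 0),
        forall i, ~~ A l i -> a 0 i = 0 & forall j, ~~ B l j -> b 0 j = 0].
  case: entry => [[i iS li]|[j lj]].
    exists (delta_mx 0 i), 0; split.
    - by move=> k k'; rewrite !mxE pnatr_eq0 eqb0 negbK => /andP[_ /eqP ->].
    - apply/orP; left; apply/eqP => /rowP/(_ i)/eqP; rewrite !mxE !eqxx.
      by rewrite oner_eq0.
    - by move=> k lk; rewrite mxE eqxx /=; case: eqP lk => // ->; rewrite li.
    - by move=> k _; rewrite mxE.
  exists 0, (delta_mx 0 j); split.
  - by move=> k k'; rewrite !mxE eqxx.
  - apply/orP; right; apply/eqP => /rowP/(_ j)/eqP; rewrite !mxE !eqxx.
    by rewrite oner_eq0.
  - by move=> k _; rewrite mxE.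
  - by move=> k lk; rewrite mxE eqxx /=; case: eqP lk => // ->; rewrite lj.
have [eps ctrl'] := attach_cycle ctrl SA SAT SB Sa ab0 SC.
have feedE p (c : 'rV[R]_p) i j : (delta_mx l 0 *m c) i j = (i == l)%:R * c 0 j.
  by rewrite mxE big_ord1 mxE eqxx andbT.
exists (S :|: C); split.
- rewrite properEneq subsetUl andbT; apply: contraNneq lS => ->.
  by rewrite inE lC orbT.
- move=> k; rewrite inE negb_or => /andP[kS kC].
  have [r kr rS] := Scl k kS; exists r => //; rewrite inE (negPf rS) /=.
  by have := mem_f k; rewrite /f (negPf kS) kr => ->.
have cycE i j : j \in C -> i = sigma j -> phi i = inl j /\ i \in C.
  move=> jC ij; have fi : f i = j by rewrite -(permE f_inj) ij permKV.
  have iC : i \in C by rewrite -mem_f fi.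
  split=> //; move: fi; rewrite /f (negPf (CS _ iC)).
  by have [r -> _] := Scl i (CS _ iC) => ->.
exists (eps *: A0 + cycle_mx sigma C + delta_mx l 0 *m a),
       (eps *: B0 + delta_mx l 0 *m b).
split=> //.
- move=> i j Aij; rewrite [LHS]mxE [X in X + _]mxE feedE !mxE rA // mulr0 add0r.
  have -> : (j \in C) && (i == sigma j) = false.
    apply/negP => /andP[jC /eqP /(cycE _ _ jC)[ij _]].
    by have := phiE i; rewrite ij /= (negPf Aij).
  rewrite add0r; case: (i =P l) => [il|]; last by rewrite mul0r.
  by rewrite aA ?mulr0 // -il.
- move=> i j Bij; rewrite mxE feedE mxE rB // mulr0 add0r.
  case: (i =P l) => [il|]; last by rewrite mul0r.
  by rewrite bB ?mulr0 // -il.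
split=> i j; rewrite inE; apply: contraNT; rewrite negb_or => /andP[iS iC].
- rewrite [X in X == _]mxE [X in X + _]mxE feedE !mxE.
  have -> : A0 i j = 0 by apply/eqP; apply: contraNT iS; apply: SA.
  have -> : (j \in C) && (i == sigma j) = false.
    by apply/negP => /andP[jC /eqP /(cycE _ _ jC)[_]]; apply/negP.
  have -> : (i == l) = false by apply/eqP => il; rewrite il lC in iC.
  by rewrite mulr0 mul0r !addr0.
- rewrite mxE [X in X == _]mxE [X in X + _]mxE feedE !mxE.
  have -> : A0 j i = 0.
    by apply/eqP; apply: contraNT iS => nz; apply: (SAT i j); rewrite mxE.
  have -> : a 0 i = 0.
    by apply/eqP; apply: contraNT iS => nz; apply: (Sa i 0); rewrite mxE.
  by rewrite (negPf iC) !mulr0 !addr0.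
- rewrite [X in X == _]mxE feedE mxE.
  have -> : B0 i j = 0 by apply/eqP; apply: contraNT iS; apply: SB.
  have -> : (i == l) = false by apply/eqP => il; rewrite il lC in iC.
  by rewrite mulr0 mul0r addr0.
Qed.

Lemma accessible_matched_controllable n m (A : 'M[bool]_n) (B : 'M[bool]_(n, m)) :
  accessible A B -> matched A B -> structurally_controllable R A B.
Proof.
move=> acc [phi phi_inj phiE].
have [S] := stems_controllable phi_inj phiE.
have [N] := ubnP #|~: S|; elim: N S => // N IH S leN Scl part.
have [ST|ST] := eqVneq S setT.
  have [A0 [B0 [rA rB _ ctrl]]] := part; exists A0, B0; split=> //.
  apply/controllableP => v unseen; apply/rowP => x; rewrite mxE.
  by apply: ctrl => //; rewrite ST inE.
have [l lS entry] := accessible_entry acc ST.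
have [S' [SS' Scl' part']] :=
  controllable_part_grow phi_inj phiE Scl part lS entry.
apply: IH Scl' part'; move: leN; rewrite !ltnS; apply: leq_trans.
by rewrite proper_card // properC.
Qed.

Lemma controllable_matched n m (A : 'M[bool]_n) (B : 'M[bool]_(n, m)) :
  structurally_controllable R A B -> matched A B.
Proof.
move=> [A0 [B0 [rA rB /controllable_row_free/row_free_matching[f f_inj fE]]]].
exists (fun k => split (f k)).
  by move=> k k' /(can_inj (@splitK _ _))/f_inj.
move=> k; have := fE k; case: split_ordP => j ->.
  by rewrite row_mxEl; apply: contraNT => /rA ->.
by rewrite row_mxEr; apply: contraNT => /rB ->.
Qed.

(** A non-top linked component without inputs evolves autonomously from rest. *)
Lemma controllable_ntl_input n m (A : 'M[bool]_n) (B : 'M[bool]_(n, m)) N :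
  structurally_controllable R A B -> N \in ntl_sccs A ->
  exists2 r, r \in N & exists j, B r j.
Proof.
move=> [A0 [B0 [rA rB /controllableP ctrl]]]; rewrite inE => /andP[Nscc Nntl].
have closed i j : i \in N -> j \notin N -> A0 i j = 0.
  move=> iN jN; apply: rA; apply: contraL Nntl => Aij.
  apply/negP => /forallP/(_ (scc_of A j)); rewrite imset_f //= => /implyP.
  have jj : j \in scc_of A j by rewrite inE !connect0.
  case: eqP => [jE|_ /(_ isT)]; first by rewrite -jE jj in jN.
  move=> /forallP/(_ j)/implyP/(_ jj)/forallP/(_ i)/implyP/(_ iN).
  by rewrite /state_edge Aij.
have /imsetP[x _ Nx] := Nscc.
have xN : x \in N by rewrite Nx inE !connect0.
have [/existsP[r /andP[rN /existsP[j rj]]]|] :=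
  boolP [exists r, (r \in N) && [exists j, B r j]].
  by exists r => //; exists j.
rewrite negb_exists => /forallP noB.
have B0N r j : r \in N -> B0 r j = 0.
  move=> rN; apply: rB; apply/negP => rj; have /negP := noB r; apply.
  by rewrite rN; apply/existsP; exists j.
have supp k : forall u : 'rV[R]_n, (forall y, y \notin N -> u 0 y = 0) ->
    u *m A0 ^+ k *m B0 = 0.
  elim: k => [|k IH] u uN.
    rewrite expr0 mulmx1; apply/rowP => j; rewrite !mxE big1 // => i _.
    by have [/B0N->|/uN->] := boolP (i \in N); rewrite ?mulr0 ?mul0r.
  rewrite exprS -mulmxE mulmxA; apply: IH => y yN; rewrite mxE big1 // => i _.
  have [iN|/uN->] := boolP (i \in N); last by rewrite mul0r.
  by rewrite closed // mulr0.
have /rowP/(_ x)/eqP : delta_mx 0 x = 0 :> 'rV[R]_n.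
  apply: ctrl => k; apply: supp => y yN; rewrite mxE eqxx /=.
  by case: eqP yN => // ->; rewrite xN.
by rewrite !mxE !eqxx oner_eq0.
Qed.
End Controllability.

(** Every state is reached from a non-top linked component: a state with the
    fewest ancestors among the ancestors of [x] lies in one. *)
Lemma ntl_ancestor n (A : 'M[bool]_n) (x : 'I_n) :
  exists2 y, scc_of A y \in ntl_sccs A & connect (state_edge A) y x.
Proof.
pose anc y := [set z | connect (state_edge A) z y].
have [y yx ymin] := arg_minnP (fun y => #|anc y|)
  (connect0 (state_edge A) x : (fun y => connect (state_edge A) y x) x).
exists y => //; rewrite inE imset_f //=; apply/forallP => M.
apply/implyP => /imsetP[z _ Mz]; apply/implyP => neq; apply/forallP => u.
apply/implyP => uM; apply/forallP => w; apply/implyP => wy; apply/negP => uw.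
have {}wy : connect (state_edge A) w y by move: wy; rewrite inE => /andP[].
have uy : connect (state_edge A) u y := connect_trans (connect1 uw) wy.
have sub : anc u \subset anc y.
  by apply/subsetP => t; rewrite !inE => /connect_trans; apply.
have ancE : anc u = anc y.
  by apply/eqP; rewrite eqEcard sub ymin // (connect_trans uy).
have yu : connect (state_edge A) y u.
  have : y \in anc u by rewrite ancE inE connect0.
  by rewrite inE.
case/eqP: neq; rewrite Mz; move: uM; rewrite Mz inE => /andP[zu uz].
have zy := connect_trans zu uy; have yz := connect_trans yu uz.
apply/setP => t; rewrite !inE; apply/andP/andP => -[h1 h2].
  by rewrite (connect_trans yz h1) (connect_trans h2 zy).
by rewrite (connect_trans zy h1) (connect_trans h2 yz).
Qed.

(** * The combinatorial form of the selection problem *)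

Definition ntl_hit n m (A : 'M[bool]_n) (B : 'M[bool]_(n, m)) (W : {set 'I_m}) :
    Prop :=
  forall N, N \in ntl_sccs A -> exists r j, [/\ r \in N, j \in W & B r j].

Definition matched_in n m (A : 'M[bool]_n) (B : 'M[bool]_(n, m))
    (W : {set 'I_m}) : Prop :=
  exists2 phi : 'I_n -> 'I_n + 'I_m, injective phi &
    forall k, matching_edge A B k (phi k) /\
              (forall j, phi k = inr j -> j \in W).

Lemma input_feasibleP (R : realType) n m (A : 'M[bool]_n) (B : 'M[bool]_(n, m))
    (W : {set 'I_m}) :
  input_feasible R A B W <-> ntl_hit A B W /\ matched_in A B W.
Proof.
rewrite /input_feasible; split=> [sc|[hit [phi phi_inj phiE]]].
  split=> [N /(controllable_ntl_input sc)[r rN [j]]|].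
    by rewrite mxE => rj; exists r, (enum_val j); rewrite enum_valP.
  have [phi phi_inj phiE] := controllable_matched sc.
  pose h (c : 'I_n + 'I_#|W|) : 'I_n + 'I_m :=
    match c with inl r => inl r | inr j => inr (enum_val j) end.
  exists (h \o phi).
    move=> k k' /= e; apply: phi_inj; move: e.
    by case: (phi k) (phi k') => [r|j] [r'|j'] //= [] => [->|/enum_val_inj->].
  move=> k; have := phiE k; rewrite /=; case: (phi k) => [r|j] /=; first by [].
  by rewrite mxE => ->; split=> // j' [<-]; apply: enum_valP.
apply: accessible_matched_controllable.
  move=> x; have [y /hit[r [j [ry jW rj]]] yx] := ntl_ancestor A x.
  exists r, (enum_rank_in jW j); rewrite mxE enum_rankK_in // rj /=.
  by apply: connect_trans yx; move: ry; rewrite inE => /andP[].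
pose emb (c : 'I_n + 'I_#|W|) : 'I_n + 'I_m :=
  match c with inl r => inl r | inr j => inr (enum_val j) end.
have /fin_all_exists[h hE] k : exists c, phi k = emb c.
  have [_] := phiE k; case: (phi k) => [r|j] inW; first by exists (inl r).
  have jW := inW j erefl.
  by exists (inr (enum_rank_in jW j)); rewrite /= enum_rankK_in.
exists h => [k k' e|k]; first by apply: phi_inj; rewrite !hE e.
by have [+ _] := phiE k; rewrite hE; case: (h k) => //= j; rewrite mxE.
Qed.

(** * Hall's theorem *)

(** Rado's argument: as long as some [G k] has two elements, one of them can be
    discarded.  Otherwise two families [K1] and [K2] containing [k], each tight
    after a removal, would contradict the condition for their union and their
    intersection. *)
Lemma hall (T U : finType) (G : T -> {set U}) :
  (forall K : {set T}, (#|K| <= #|\bigcup_(k in K) G k|)%N) ->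
  exists2 f : T -> U, injective f & forall k, f k \in G k.
Proof.
have [N] := ubnP (\sum_k #|G k|); elim: N G => // N IH G leN hG.
have G_gt0 k : (0 < #|G k|)%N by have := hG [set k]; rewrite cards1 big_set1.
have [/forallP G1|] := boolP [forall k, #|G k| <= 1]%N.
  have /fin_all_exists[f fG] k : exists x, x \in G k.
    by have /card_gt0P := G_gt0 k.
  exists f => // k k' fkk'; apply/eqP; apply/negPn/negP => kk'.
  have := hG [set k; k']; rewrite cards2 kk' bigcup_setU !big_set1.
  have [Gk Gk'] : #|G k| = 1%N /\ #|G k'| = 1%N.
    by split; apply/eqP; rewrite eqn_leq G1 G_gt0.
  have /cards1P[x Gkx] := introT eqP Gk; have /cards1P[y Gky] := introT eqP Gk'.
  have := fG k; have := fG k'; rewrite Gkx Gky !inE => /eqP <- /eqP <-.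
  by rewrite fkk' setUid cards1.
rewrite negb_forall => /existsP[k0]; rewrite -ltnNge.
move=> /card_gt1P[x [y [xG yG xy]]].
pose G' z k := if k == k0 then G k :\ z else G k.
have G'S z k : G' z k \subset G k.
  by rewrite /G'; case: ifP => // _; apply: subD1set.
have shrink z : z \in G k0 ->
    (forall K : {set T}, (#|K| <= #|\bigcup_(k in K) G' z k|)%N) ->
    exists2 f : T -> U, injective f & forall k, f k \in G k.
  move=> zG hz; have [|f f_inj fG] := IH (G' z) _ hz.
    move: leN; rewrite !ltnS; apply: leq_trans.
    rewrite [X in (_ <= X)%N](bigD1 k0) //= [X in (X < _)%N](bigD1 k0) //= -addSn.
    apply: leq_add; first by rewrite /G' eqxx [X in (_ <= X)%N](cardsD1 z) zG.
    by apply: leq_sum => k _; apply: subset_leq_card.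
  by exists f => // k; apply: subsetP (G'S z k) _ (fG k).
have [/forallP hx|] :=
  boolP [forall K : {set T}, #|K| <= #|\bigcup_(k in K) G' x k|]%N.
  exact: shrink xG hx.
rewrite negb_forall => /existsP[K1]; rewrite -ltnNge => lt1.
apply: shrink yG _ => K2; rewrite leqNgt; apply/negP => lt2.
have contains z (K : {set T}) : (#|\bigcup_(k in K) G' z k| < #|K|)%N -> k0 \in K.
  move=> lt; apply/negPn/negP => k0K; have := hG K; rewrite leqNgt => /negP; apply.
  rewrite (eq_bigr (G' z)) // => k kK; rewrite /G'; case: eqP => // kk0.
  by rewrite -kk0 kK in k0K.
have k1 := contains _ _ lt1; have k2 := contains _ _ lt2.
have sub_U : \bigcup_(k in K1 :|: K2) G k \subset
    \bigcup_(k in K1) G' x k :|: \bigcup_(k in K2) G' y k.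
  apply/subsetP => z /bigcupP[k kK zk]; rewrite inE.
  have [kk0|kk0] := eqVneq k k0.
    have [zx|zx] := eqVneq z x.
      apply/orP; right; apply/bigcupP; exists k0 => //.
      by rewrite /G' eqxx !inE zx xy.
    apply/orP; left; apply/bigcupP; exists k0 => //.
    by rewrite /G' eqxx !inE zx -kk0.
  move: kK; rewrite inE => /orP[kK|kK]; apply/orP; [left|right];
    by apply/bigcupP; exists k; rewrite // /G' (negPf kk0).
have sub_I : \bigcup_(k in K1 :&: K2 :\ k0) G k \subset
    \bigcup_(k in K1) G' x k :&: \bigcup_(k in K2) G' y k.
  apply/subsetP => z /bigcupP[k]; rewrite !inE => /and3P[kk0 kK1 kK2] zk.
  by apply/andP; split; apply/bigcupP; exists k; rewrite // /G' (negPf kk0).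
have := leq_trans (hG _) (subset_leq_card sub_U).
have := leq_trans (hG _) (subset_leq_card sub_I).
have := cardsUI (\bigcup_(k in K1) G' x k) (\bigcup_(k in K2) G' y k).
have := cardsUI K1 K2.
have := cardsD1 k0 (K1 :&: K2); rewrite inE k1 k2 /=.
move: lt1 lt2.
set a1 := #|\bigcup_(k in K1) _|; set a2 := #|\bigcup_(k in K2) _|.
set b1 := #|_ :|: \bigcup_(k in K2) _|; set b2 := #|_ :&: \bigcup_(k in K2) _|.
lia.
Qed.

(** Hall's condition holds for the support: the rows of [K] send [#|K|] units to
    their neighbours, each of which absorbs at most one. *)
Lemma fractional_matching (R : realType) (T U : finType) (w : T -> U -> R) :
  (forall k u, 0 <= w k u) -> (forall k, \sum_u w k u = 1) ->
  (forall u, \sum_k w k u <= 1) ->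
  exists2 f : T -> U, injective f & forall k, 0 < w k (f k).
Proof.
move=> w0 row col; pose G k := [set u | 0 < w k u].
have [|f f_inj fG] := @hall _ _ G; last first.
  by exists f => // k; have := fG k; rewrite inE.
move=> K; rewrite -(ler_nat R); set N := \bigcup_(k in K) G k.
have -> : #|K|%:R = \sum_(k in K) \sum_u w k u :> R.
  by rewrite (eq_bigr (fun=> 1)) // sumr_const.
have -> : #|N|%:R = \sum_(u in N) 1 :> R by rewrite sumr_const.
rewrite exchange_big /= (bigID (mem N)) /= [X in _ + X]big1 ?addr0.
  apply: ler_sum => u _; apply: le_trans (col u).
  by rewrite [leRHS](bigID (mem K)) /= lerDl; apply: sumr_ge0.
move=> u uN; apply: big1 => k kK; apply/eqP; rewrite eq_le w0 andbT leNgt.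
by apply: contra uN => wku; apply/bigcupP; exists k => //; rewrite inE.
Qed.

(** * Flows *)

(** ** Flows as functions on pairs of vertices *)

Section Flows.
Variables (R : realType) (n m : nat) (A : 'M[bool]_n) (B : 'M[bool]_(n, m)).
Implicit Types (f : edge A B -> R) (F : vertex m A -> vertex m A -> R).

(** Extending a flow by zero to all pairs turns sums over the edges at a vertex
    into sums over vertices. *)
Definition pair_flow f (v w : vertex m A) : R :=
  if insub (v, w) is Some e then f e else 0.

Lemma pair_flow_val f (e : edge A B) : pair_flow f (val e).1 (val e).2 = f e.
Proof. by rewrite /pair_flow -surjective_pairing valK. Qed.

Definition supported F : Prop := forall v w, ~~ is_edge B (v, w) -> F v w = 0.

Lemma pair_flow_supported f : supported (pair_flow f).
Proof. by move=> v w vw; rewrite /pair_flow insubN. Qed.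

Lemma big_edge F (P : pred (vertex m A * vertex m A)) : supported F ->
  \sum_(e : edge A B | P (val e)) F (val e).1 (val e).2 =
  \sum_(p | P p) F p.1 p.2.
Proof.
move=> F0; rewrite (bigID (fun p => is_edge B p)) /= [X in _ + X]big1; last first.
  by move=> [v w] /andP[_ /F0].
rewrite addr0 (reindex_omap (val : edge A B -> _) insub) => [|p /andP[_ pe]].
  by apply: eq_bigl => e; rewrite valK eqxx andbT (valP e) andbT.
by rewrite insubT /=.
Qed.

Lemma big_tail F v : supported F ->
  \sum_(e : edge A B | edge_tail e == v) F (val e).1 (val e).2 = \sum_w F v w.
Proof.
move=> /(big_edge (fun p => p.1 == v)) ->.
transitivity (\sum_(u | u == v) \sum_w F u w); last by rewrite big_pred1_eq.
by rewrite pair_big; apply: eq_bigl => p; rewrite andbT.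
Qed.

Lemma big_head F v : supported F ->
  \sum_(e : edge A B | edge_head e == v) F (val e).1 (val e).2 = \sum_w F w v.
Proof.
move=> /(big_edge (fun p => p.2 == v)) ->.
transitivity (\sum_u \sum_(w | w == v) F u w); first by rewrite pair_big.
by apply: eq_bigr => u _; rewrite big_pred1_eq.
Qed.

Lemma big_vertex (G : vertex m A -> R) :
  \sum_v G v = G Source + G Sink + \sum_N G (Scc N) + \sum_k G (Xp k) +
               \sum_r G (X r) + \sum_j G (U j) + \sum_j G (Up j).
Proof.
rewrite (reindex (@vertex_of_sum n m A)) /=; last first.
  apply: onW_bij; exists (@vertex_to_sum n m A); last exact: vertex_to_sumK.
  by case=> [[]|[N|[[k|r]|[j|j]]]].
rewrite !big_sumType /= big_bool /=; ring.
Qed.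

(** Conservation for each kind of vertex, without the pairs that are no edges. *)
Record conserved F : Prop := Conserved {
  conserved_Scc : forall N, \sum_j F (Scc N) (Up j) = F Source (Scc N);
  conserved_Xp : forall k, \sum_r F (Xp k) (X r) + \sum_j F (Xp k) (U j) =
                           F Source (Xp k);
  conserved_X : forall r, F (X r) Sink = \sum_k F (Xp k) (X r);
  conserved_U : forall j, F (U j) (Up j) = \sum_k F (Xp k) (U j);
  conserved_Up : forall j,
    F (Up j) Sink = \sum_N F (Scc N) (Up j) + F (U j) (Up j) }.

Lemma conservedP F : supported F ->
  (forall v, v != Source -> v != Sink -> \sum_w F v w = \sum_w F w v) <->
  conserved F.
Proof.
move=> F0.
have z v w : is_edge B (v, w) = false -> F v w = 0 by move=> h; apply: F0; rewrite h.
have UpE j : \sum_i F (U i) (Up j) = F (U j) (Up j).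
  rewrite (bigD1 j) //= big1 ?addr0 // => i ij; apply: F0 => /=.
  by rewrite (negPf ij).
have UE j : \sum_i F (U j) (Up i) = F (U j) (Up j).
  rewrite (bigD1 j) //= big1 ?addr0 // => i ij; apply: F0 => /=.
  by rewrite eq_sym (negPf ij).
have zs (I : finType) (v w : I -> vertex m A) :
    (forall i, is_edge B (v i, w i) = false) -> \sum_i F (v i) (w i) = 0.
  by move=> h; apply: big1 => i _; apply: z.
pose io v :=
  match v with
  | Source => (\sum_N F Source (Scc N) + \sum_k F Source (Xp k), 0)
  | Sink => (0, \sum_r F (X r) Sink + \sum_j F (Up j) Sink)
  | Scc N => (\sum_j F (Scc N) (Up j), F Source (Scc N))
  | Xp k => (\sum_r F (Xp k) (X r) + \sum_j F (Xp k) (U j), F Source (Xp k))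
  | X r => (F (X r) Sink, \sum_k F (Xp k) (X r))
  | U j => (F (U j) (Up j), \sum_k F (Xp k) (U j))
  | Up j => (F (Up j) Sink, \sum_N F (Scc N) (Up j) + F (U j) (Up j))
  end.
have ioE v : (\sum_w F v w, \sum_w F w v) = io v.
  rewrite /io; case: v => [||N|k|r|j|j]; rewrite !big_vertex ?UpE ?UE;
    repeat match goal with
    | |- context [F ?v ?w] => rewrite (z v w erefl)
    | |- context [\sum_i F (@?v i) (@?w i)] => rewrite (zs _ v w (fun=> erefl))
    end; by rewrite ?add0r ?addr0.
have outE v : \sum_w F v w = (io v).1 by rewrite -ioE.
have inE' v : \sum_w F w v = (io v).2 by rewrite -ioE.
split=> [cons|[cN ck cr cj cj'] v vS vT].
  have {}cons v : v != Source -> v != Sink -> (io v).1 = (io v).2.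
    by move=> vS vT; rewrite -outE -inE' cons.
  by split=> x; [apply: (cons (Scc x)) | apply: (cons (Xp x))
                |apply: (cons (X x)) | apply: (cons (U x)) | apply: (cons (Up x))].
by rewrite outE inE'; case: v vS vT => [||N|k|r|j|j] //= _ _.
Qed.

Lemma value_sum F : supported F ->
  \sum_(e : edge A B | edge_tail e == Source) F (val e).1 (val e).2 =
  \sum_N F Source (Scc N) + \sum_k F Source (Xp k).
Proof.
move=> F0; rewrite big_tail // big_vertex !F0 //.
rewrite [X in _ + X]big1 => [|j _]; last exact: F0.
rewrite [X in _ + X + _]big1 => [|j _]; last exact: F0.
rewrite [X in _ + X + _ + _]big1 => [|j _]; last exact: F0.
by rewrite !add0r !addr0.
Qed.

(** Only the edges from [Up j] to the sink have a cost. *)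
Lemma flow_costE (pu : 'I_m -> R) f :
  flow_cost pu f = input_cost pu (selected_inputs f).
Proof.
pose up (e : edge A B) := if val e is (Up j, Sink) then Some j else None.
rewrite /flow_cost (bigID (fun e => up e != None)) /= [X in _ + X]big1 ?addr0.
  rewrite (reindex_omap (@up_edge n m A B) up) => [|[[v w] vw]] /=.
    by apply: eq_bigl => j; rewrite inE /up /= eqxx !andbT.
  move=> /andP[_]; rewrite /up /=; case: v w vw => [||?|?|?|?|j] [||?|?|?|?|?] //.
  by move=> vw _; congr Some; apply: val_inj.
move=> [[v w] vw] /andP[_]; rewrite negbK /up /edge_cost /=.
by case: v w vw => [||?|?|?|?|j] [||?|?|?|?|?].
Qed.

(** ** From flows to selections *)

(** The demand saturates every edge that leaves the source.  A saturated
    component node sends flow to a selected input.  The flow through the nodes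
    [Xp k] is a fractional matching, as one unit at most passes through each
    node [X r] or [U j]. *)
Lemma MCFF_input_feasible f :
  MCFF_feasible (ntl_count A + n) f -> input_feasible R A B (selected_inputs f).
Proof.
move=> [[f0 fcap fcons] fval]; apply/input_feasibleP.
pose F := pair_flow f; have F0 : supported F := pair_flow_supported f.
have Fe v w (vw : is_edge B (v, w)) : F v w = f (exist _ (v, w) vw).
  exact: (pair_flow_val f (exist _ (v, w) vw)).
have Fge0 v w : 0 <= F v w.
  by have [vw|/F0->//] := boolP (is_edge B (v, w)); rewrite Fe.
have sumF (P : pred (edge A B)) :
    \sum_(e | P e) F (val e).1 (val e).2 = \sum_(e | P e) f e.
  by apply: eq_bigr => e _; apply: pair_flow_val.
have [cN ck cr cj cj'] : conserved F.
  apply/conservedP => // v vS vT; rewrite -big_tail // -big_head //.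
  by rewrite !sumF; apply: fcons.
have le1 v w : w != Sink -> F v w <= 1.
  have [vw|/F0->//] := boolP (is_edge B (v, w)); rewrite Fe.
  move=> wT; apply: le_trans (fcap _) _; rewrite /capacity /=.
  by case: v w vw wT => [||?|?|?|?|?] [||?|?|?|?|?].
have XT r : F (X r) Sink <= 1.
  by rewrite (Fe (X r) Sink isT); apply: le_trans (fcap _) _.
have [sat_N sat_k] :
    (forall N, F Source (Scc N) = 1) /\ (forall k, F Source (Xp k) = 1).
  pose dN (N : ntl_scc A) := 1 - F Source (Scc N).
  pose dk k := 1 - F Source (Xp k).
  have dN0 N : 0 <= dN N by rewrite subr_ge0 le1.
  have dk0 k : 0 <= dk k by rewrite subr_ge0 le1.
  have sN0 : 0 <= \sum_N dN N by apply: sumr_ge0.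
  have sk0 : 0 <= \sum_k dk k by apply: sumr_ge0.
  have le0 : \sum_N dN N + \sum_k dk k <= 0.
    rewrite !sumrB !sumr_const cardT -cardE card_sig card_ord.
    by move: fval; rewrite /flow_value -sumF value_sum // natrD /ntl_count; lra.
  have [sN sk] : \sum_N dN N = 0 /\ \sum_k dk k = 0 by split; lra.
  split=> x; apply/esym/eqP; rewrite -subr_eq0; apply/eqP.
    by move/eqP: sN; rewrite psumr_eq0 // => /allP/(_ x)/(_ (mem_index_enum _))/eqP.
  by move/eqP: sk; rewrite psumr_eq0 // => /allP/(_ x)/(_ (mem_index_enum _))/eqP.
have selected j : (j \in selected_inputs f) = (0 < F (Up j) Sink).
  by rewrite inE (Fe (Up j) Sink isT).
split.
  move=> N HN; have := cN (exist _ N HN); rewrite sat_N => sum1.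
  have [j Fj] : exists j, 0 < F (Scc (exist _ N HN)) (Up j).
    have [/existsP//|] := boolP [exists j, 0 < F (Scc (exist _ N HN)) (Up j)].
    rewrite negb_exists => /forallP h.
    have /eqP := sum1; rewrite big1 ?(eq_sym 0) ?oner_eq0 // => j _.
    by apply/eqP; rewrite eq_le Fge0 andbT leNgt.
  have [|/F0 h] := boolP (is_edge B (Scc (exist _ N HN), Up j)); last first.
    by rewrite h ltxx in Fj.
  move=> /= /existsP[r /andP[rN rj]]; exists r, j; split=> //.
  rewrite selected cj'; apply: ltr_wpDr => //.
  rewrite (bigD1 (exist _ N HN)) //=; apply: ltr_wpDr => //.
  by apply: sumr_ge0.
pose w k (c : 'I_n + 'I_m) :=
  match c with inl r => F (Xp k) (X r) | inr j => F (Xp k) (U j) end.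
have [||[r|j]|phi phi_inj phi_gt0] := @fractional_matching R _ _ w.
- by move=> k [r|j]; apply: Fge0.
- by move=> k; rewrite big_sumType /= ck sat_k.
- by rewrite /w -cr.
- by rewrite /w -cj le1.
exists phi => // k; have := phi_gt0 k; case: (phi k) => [r|j] /= Fk; split=> //.
- have [//|/(F0 (Xp k) (X r)) h] := boolP (A k r).
  by rewrite h ltxx in Fk.
- have [//|/(F0 (Xp k) (U j)) h] := boolP (B k j).
  by rewrite h ltxx in Fk.
move=> _ [<-]; rewrite selected cj'; apply: ltr_wpDl; first exact: sumr_ge0.
by rewrite cj (bigD1 k) //=; apply: ltr_wpDr => //; apply: sumr_ge0.
Qed.

(** ** From selections to flows *)

(** Each component is routed to a selected input that hits it and each vertex
    [Xp k] along the matching. *)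
Lemma input_feasible_MCFF (pu : 'I_m -> R) (W : {set 'I_m}) :
  (forall j, 0 <= pu j) -> input_feasible R A B W ->
  exists2 f : edge A B -> R, MCFF_feasible (ntl_count A + n) f &
    flow_cost pu f <= input_cost pu W.
Proof.
move=> pu0 /input_feasibleP[hit [phi phi_inj phiE]].
have /fin_all_exists[hN hNE] (N : ntl_scc A) : exists j,
    (j \in W) && [exists r in val N, B r j].
  have [r [j [rN jW rj]]] := hit _ (valP N); exists j; rewrite jW.
  by apply/existsP; exists r; rewrite rN.
pose load (c : 'I_n + 'I_m) : R := \sum_k (phi k == c)%:R.
pose hits j : R := \sum_(N : ntl_scc A) (hN N == j)%:R.
pose F (v w : vertex m A) : R :=
  match v, w with
  | Source, Scc _ | Source, Xp _ => 1
  | Scc N, Up j => (hN N == j)%:R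
  | Xp k, X r => (phi k == inl r)%:R
  | Xp k, U j => (phi k == inr j)%:R
  | U i, Up j => (i == j)%:R * load (inr j)
  | X r, Sink => load (inl r)
  | Up j, Sink => hits j + load (inr j)
  | _, _ => 0
  end.
have load_ge0 c : 0 <= load c by apply: sumr_ge0.
have load_le1 c : load c <= 1.
  have [/existsP[k /eqP <-]|] := boolP [exists k, phi k == c].
    rewrite /load (bigD1 k) //= eqxx big1 ?addr0 // => k' k'k.
    by rewrite (inj_eq phi_inj) (negPf k'k).
  rewrite negb_exists => /forallP h.
  by rewrite /load big1 // => k _; rewrite (negPf (h k)).
have hits_ge0 j : 0 <= hits j by apply: sumr_ge0.
have hits_le j : hits j <= n%:R.
  apply: le_trans (_ : \sum_(N : ntl_scc A) 1 <= _).
    by apply: ler_sum => N _; case: eqP.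
  rewrite sumr_const cardT -cardE card_sig ler_nat.
  apply: leq_trans (_ : #|sccs A| <= _)%N.
    by apply: subset_leq_card; apply/subsetP => N; rewrite inE => /andP[].
  by apply: leq_trans (leq_imset_card _ _) _; rewrite card_ord.
have F0 : supported F.
  move=> [||N|k|r|i|i] [||N'|k'|r'|j|j] //= h.
  - case: eqP => // hNj; case/negP: h; rewrite -hNj.
    by have /andP[] := hNE N.
  - case: eqP => // kr; case/negP: h; have [+ _] := phiE k.
    by rewrite kr.
  - case: eqP => // kr; case/negP: h; have [+ _] := phiE k.
    by rewrite kr.
  - by rewrite (negPf h) mul0r.
have cons : conserved F.
  split=> [N|k|r|j|j] //=.
  - rewrite (bigD1 (hN N)) //= eqxx big1 ?addr0 // => j jN.
    by rewrite eq_sym (negPf jN).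
  - transitivity (\sum_c (phi k == c)%:R : R); first by rewrite big_sumType.
    rewrite (bigD1 (phi k)) //= eqxx big1 ?addr0 // => c ck.
    by rewrite eq_sym (negPf ck).
  - by rewrite eqxx mul1r.
  - by rewrite eqxx mul1r.
exists (fun e => F (val e).1 (val e).2).
  split; first split.
  - move=> [[v w] vw] /=; case: v w {vw} => [||N|k|r|i|i] [||N'|k'|r'|j|j] //=.
    + by rewrite mulr_ge0.
    + by rewrite addr_ge0.
  - move=> [[v w] vw]; rewrite /capacity /=.
    case: v w {vw} => [||N|k|r|i|i] [||N'|k'|r'|j|j] //=;
      rewrite ?lern1 ?leq_b1 //.
    + by case: eqP; rewrite ?mul1r ?mul0r.
    + by rewrite -natr1 lerD.
  - move=> v vS vT; rewrite big_tail // big_head //.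
    exact: (iffRL (conservedP F0) cons).
  rewrite /flow_value value_sum // !sumr_const cardT -cardE card_sig card_ord.
  by rewrite natrD.
rewrite flow_costE /input_cost [leRHS](bigID (mem (selected_inputs
  (fun e : edge A B => F (val e).1 (val e).2)))) /=.
rewrite [leLHS](eq_bigl (fun j => (j \in W) && (j \in selected_inputs
  (fun e : edge A B => F (val e).1 (val e).2)))).
  by rewrite lerDl; apply: sumr_ge0.
move=> j; case jsel: (j \in selected_inputs _) => /=; rewrite ?andbF // andbT.
move: jsel; rewrite inE /= => pos; apply/esym; apply: contraTT pos => jW.
rewrite -leNgt /hits /load !big1 ?addr0 // => [k _|N _]; case: eqP => //.
  by move=> kj; have [_ /(_ j kj)] := phiE k; rewrite (negPf jW).
by move=> Nj; have := hNE N; rewrite Nj (negPf jW).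
Qed.

(** A flow selects a feasible set of the same cost, and a feasible set carries a
    flow that costs no more, so minimizers correspond. *)
Theorem MCFF_minCCIS (pu : 'I_m -> R) :
  structurally_controllable R A B -> (forall j, 0 <= pu j) ->
  (forall f : edge A B -> R,
     MCFF_optimal pu (ntl_count A + n) f ->
     minCCIS_optimal A B pu (selected_inputs f)) /\
  (exists v : R,
     minCCIS_value A B pu v /\ MCFF_value A B pu (ntl_count A + n) v).
Proof.
move=> sc pu0; split=> [f [f_feas f_opt]|].
  split=> [|W /(input_feasible_MCFF pu0)[g g_feas g_le]].
    exact: MCFF_input_feasible.
  by rewrite -flow_costE; apply: le_trans g_le; apply: f_opt.
have feasT : input_feasible R A B setT.
  apply/input_feasibleP; split=> [N HN|].
    have [r rN [j rj]] := controllable_ntl_input sc HN.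
    by exists r, j; rewrite inE.
  have [phi phi_inj phiE] := controllable_matched sc.
  by exists phi => // k; split=> // j _; rewrite inE.
have [I [I_feas I_opt]] : exists I, minCCIS_optimal A B pu I.
  pose feas W := `[< input_feasible R A B W >].
  have [|I /asboolP I_feas I_min] := @arg_minP _ _ _ setT feas (input_cost pu).
    exact/asboolP.
  by exists I; split=> // W W_feas; apply/I_min/asboolP.
exists (input_cost pu I); split; first by exists I.
have [g g_feas g_le] := input_feasible_MCFF pu0 I_feas.
have lower f : MCFF_feasible (ntl_count A + n) f -> input_cost pu I <= flow_cost pu f.
  by move=> /MCFF_input_feasible; rewrite flow_costE; apply: I_opt.
have gE : flow_cost pu g = input_cost pu I by apply/eqP; rewrite eq_le g_le lower.
by exists g => //; split=> // h h_feas; rewrite gE lower.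
Qed.
End Flows.

(** * Reasoning about programs *)

Local Open Scope nat_scope.

Section ProgramLogic.
Variable R : realType.
Implicit Types (s : state R) (c : cmd) (e : expr) (Q : state R -> Prop).

(** Total correctness with a budget of [T] steps. *)
Definition runs s c T Q : Prop :=
  exists t s', [/\ exec c s t s', t <= T & Q s'].

Lemma runs_le s c T T' Q Q' :
  runs s c T Q -> T <= T' -> (forall s', Q s' -> Q' s') -> runs s c T' Q'.
Proof.
move=> [t [s' [ex tT Qs']]] TT' QQ'; exists t, s'; split=> //; last exact: QQ'.
exact: leq_trans tT TT'.
Qed.

Lemma runs_seq s c1 c2 T1 T2 Q :
  runs s c1 T1 (fun s1 => runs s1 c2 T2 Q) -> runs s (Seq c1 c2) (T1 + T2) Q.
Proof.
move=> [t1 [s1 [ex1 le1 [t2 [s2 [ex2 le2 Qs2]]]]]].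
by exists (t1 + t2), s2; split; [apply: ExecSeq ex1 ex2 | apply: leq_add |].
Qed.

Lemma runs_if s e c1 c2 T1 T2 Q :
  (eval s e != 0 -> runs s c1 T1 Q) -> (eval s e = 0 -> runs s c2 T2 Q) ->
  runs s (If e c1 c2) ((steps e).+1 + maxn T1 T2) Q.
Proof.
move=> h1 h2; have [e0|e0] := eqVneq (eval s e) 0.
  have [t [s' [ex le Qs']]] := h2 e0.
  exists ((steps e).+1 + t), s'; split=> //; first exact: ExecIfFalse.
  by rewrite leq_add2l (leq_trans le) ?leq_maxr.
have [t [s' [ex le Qs']]] := h1 e0.
exists ((steps e).+1 + t), s'; split=> //; first exact: ExecIfTrue.
by rewrite leq_add2l (leq_trans le) ?leq_maxl.
Qed.

(** ** Straight-line code *)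

Fixpoint time c : nat :=
  match c with
  | SetReg _ e => (steps e).+1
  | Put _ i j e => (steps i + steps j + steps e).+1
  | MoveCost _ i _ j => (steps i + steps j).+1
  | ZeroCost _ i => (steps i).+1
  | Seq c1 c2 => time c1 + time c2
  | If e c1 c2 => (steps e).+1 + maxn (time c1) (time c2)
  | While _ _ => 0
  end.

(** Loops have no weakest precondition here: they have their own rules. *)
Fixpoint wp c Q s : Prop :=
  match c with
  | SetReg x e => Q (set_reg s x (eval s e))
  | Put a i j e => Q (set_arr s a (eval s i) (eval s j) (eval s e))
  | MoveCost a i b j => Q (set_cst s a (eval s i) (cst s b (eval s j)))
  | ZeroCost a i => Q (set_cst s a (eval s i) 0%R)
  | Seq c1 c2 => wp c1 (wp c2 Q) s
  | If e c1 c2 =>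
      (eval s e != 0 -> wp c1 Q s) /\ (eval s e = 0 -> wp c2 Q s)
  | While _ _ => False
  end.

Lemma wp_runs c Q s : wp c Q s -> runs s c (time c) Q.
Proof.
elim: c Q s => [x e|a i j e|a i b j|a i|c1 IH1 c2 IH2|e c1 IH1 c2 IH2|e c _] Q s //=.
- by move=> h; eexists; eexists; split; [apply: ExecSetReg | |].
- by move=> h; eexists; eexists; split; [apply: ExecPut | |].
- by move=> h; eexists; eexists; split; [apply: ExecMoveCost | |].
- by move=> h; eexists; eexists; split; [apply: ExecZeroCost | |].
- by move=> /IH1 h; apply: runs_seq; apply: runs_le h _ _ => // s' /IH2.
by move=> [h1 h2]; apply: runs_if => e0; [apply/IH1/h1 | apply/IH2/h2].
Qed.

(** ** Framing *)

Fixpoint writes_reg x c : bool :=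
  match c with
  | SetReg y _ => x == y
  | Seq c1 c2 | If _ c1 c2 => writes_reg x c1 || writes_reg x c2
  | While _ c => writes_reg x c
  | _ => false
  end.

Fixpoint writes_arr a c : bool :=
  match c with
  | Put b _ _ _ => a == b
  | Seq c1 c2 | If _ c1 c2 => writes_arr a c1 || writes_arr a c2
  | While _ c => writes_arr a c
  | _ => false
  end.

Fixpoint writes_cst a c : bool :=
  match c with
  | MoveCost b _ _ _ | ZeroCost b _ => a == b
  | Seq c1 c2 | If _ c1 c2 => writes_cst a c1 || writes_cst a c2
  | While _ c => writes_cst a c
  | _ => false
  end.

(** The part of the memory that the text of [c] does not assign. *)
Definition same c s s' : Prop :=
  [/\ forall x, ~~ writes_reg x c -> reg s' x = reg s x,
      forall a i j, ~~ writes_arr a c -> arr s' a i j = arr s a i j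
    & forall a i, ~~ writes_cst a c -> cst s' a i = cst s a i].

Lemma exec_same c s t s' : exec c s t s' -> same c s s'.
Proof.
elim=> {c s t s'} //=.
- by move=> x e s; split=> //= y /negPf ->.
- by move=> a i j e s; split=> //= b k l /negPf ->.
- by move=> a i b j s; split=> //= b' k /negPf ->.
- by move=> a i s; split=> //= b k /negPf ->.
- move=> c1 c2 s t1 s1 t2 s2 _ [r1 a1 k1] _ [r2 a2 k2].
  split=> [x|a i j|a i] /=; rewrite negb_or => /andP[h1 h2].
  + by rewrite r2 // r1.
  + by rewrite a2 // a1.
  + by rewrite k2 // k1.
- move=> e c1 c2 s t s' _ _ [r1 a1 k1].
  by split=> [x|a i j|a i] /=; rewrite negb_or => /andP[h1 h2]; auto.
- move=> e c1 c2 s t s' _ _ [r1 a1 k1].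
  by split=> [x|a i j|a i] /=; rewrite negb_or => /andP[h1 h2]; auto.
- move=> e c s t1 s1 t2 s2 _ _ [r1 a1 k1] _ [r2 a2 k2].
  split=> [x|a i j|a i] /= h.
  + by rewrite r2 // r1.
  + by rewrite a2 // a1.
  + by rewrite k2 // k1.
Qed.

Lemma runs_same s c T Q :
  runs s c T Q -> runs s c T (fun s' => Q s' /\ same c s s').
Proof.
move=> [t [s' [ex le Qs']]]; exists t, s'; split=> //.
by split=> //; apply: exec_same ex.
Qed.

(** ** Loops *)

(** The potential [mu] bounds the number of rounds. *)
Lemma runs_while e c T (I : state R -> Prop) (mu : state R -> nat) s :
  I s ->
  (forall s, I s -> eval s e != 0 ->
     runs s c T (fun s' => I s' /\ mu s' < mu s)) ->
  runs s (While e c) (mu s * ((steps e).+1 + T) + (steps e).+1)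
    (fun s' => I s' /\ eval s' e = 0).
Proof.
move=> + step; have [N] := ubnP (mu s); elim: N s => // N IH s leN Is.
have [e0|e0] := eqVneq (eval s e) 0.
  exists (steps e).+1, s; split=> //; first exact: ExecWhileFalse.
  exact: leq_addl.
have [t1 [s1 [ex1 le1 [Is1 dec]]]] := step s Is e0.
have [|t2 [s2 [ex2 le2 Qs2]]] := IH s1 _ Is1; first exact: leq_trans dec _.
exists ((steps e).+1 + t1 + t2), s2; split=> //.
  exact: ExecWhileTrue ex1 ex2.
apply: leq_trans (leq_add (leq_add (leqnn _) le1) le2) _.
by rewrite addnA -mulSn leq_add2r leq_mul2r dec orbT.
Qed.

Definition For x lim c : cmd :=
  Seq (SetReg x (Cst 0))
      (While (Lt (Reg x) (Reg lim)) (Seq c (SetReg x (Succ (Reg x))))).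

Definition for_time N T : nat := 2 + (N * (T + 7) + 4).

Lemma runs_for x lim c T N (I : nat -> state R -> Prop) s :
  x != lim -> ~~ writes_reg x c -> ~~ writes_reg lim c ->
  reg s lim = N -> I 0 (set_reg s x 0) ->
  (forall i s, i < N -> I i s -> reg s x = i ->
     runs s c T (fun s' => I i.+1 (set_reg s' x i.+1))) ->
  runs s (For x lim c) (for_time N T) (I N).
Proof.
move=> xlim cx clim limN I0 step; apply: runs_seq.
apply: (@wp_runs (SetReg x (Cst 0))) => /=.
pose J s := [/\ I (reg s x) s, reg s x <= N & reg s lim = N].
pose mu s := N - reg s x.
have J0 : J (set_reg s x 0).
  by rewrite /J /= eqxx eq_sym (negPf xlim).
apply: runs_le (@runs_while _ _ (T + 3) J mu _ J0 _) _ _.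
- move=> s1 [Is1 le1 lim1] /=; rewrite lim1 eqb0 negbK => lt1.
  apply: runs_seq; apply: runs_le (runs_same (step _ _ lt1 Is1 erefl)) (leqnn _) _.
  move=> s2 [Is2 [r2 _ _]]; apply: (@wp_runs (SetReg x (Succ (Reg x)))) => /=.
  rewrite /J /mu /= eqxx eq_sym (negPf xlim) !r2 //; split=> //.
  by rewrite ltn_sub2l.
- rewrite /mu /= eqxx subn0; lia.
move=> s' [[Is' le' lim'] /=]; rewrite lim' => /eqP; rewrite eqb0 -leqNgt => ge'.
by have -> : N = reg s' x by apply/eqP; rewrite eqn_leq ge'.
Qed.
End ProgramLogic.

(** * Searching for roots *)

(** The roots of the trees of a search that restarts at each candidate that is
    still unvisited. *)
Definition greedy (T : finType) (E : rel T) (cs : seq T) : seq T :=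
  foldl (fun rs c => if has (fun r => connect E r c) rs then rs else rcons rs c)
        [::] cs.

Lemma greedy_rcons (T : finType) (E : rel T) cs c :
  greedy E (rcons cs c) =
  if has (fun r => connect E r c) (greedy E cs) then greedy E cs
  else rcons (greedy E cs) c.
Proof. by rewrite /greedy foldl_rcons. Qed.

Lemma greedy_subseq (T : finType) (E : rel T) cs : subseq (greedy E cs) cs.
Proof.
elim/last_ind: cs => [|cs c IH] //; rewrite greedy_rcons -[rcons cs c]cats1.
case: ifP => _; first by apply: subseq_trans IH _; apply: prefix_subseq.
by rewrite -cats1; apply: cat_subseq.
Qed.

Lemma greedy_reach (T : finType) (E : rel T) cs c : c \in cs ->
  exists2 r, r \in greedy E cs & connect E r c.
Proof.
elim/last_ind: cs => [|cs d IH] //; rewrite mem_rcons inE greedy_rcons.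
case: (boolP (has _ _)) => [/hasP[r rin rd]|_] /predU1P[->|/IH[r0 r0in r0c]].
- by exists r.
- by exists r0.
- by exists d; rewrite ?mem_rcons ?inE ?eqxx.
- by exists r0; rewrite // mem_rcons inE r0in orbT.
Qed.

Lemma greedy_pairwise (T : finType) (E : rel T) cs :
  pairwise (fun x y => ~~ connect E x y) (greedy E cs).
Proof.
elim/last_ind: cs => [|cs d IH] //; rewrite greedy_rcons.
case: (boolP (has _ _)) => // hd; rewrite pairwise_rcons IH andbT.
by rewrite -all_predC in hd.
Qed.

Definition first_reach (T : finType) (E : rel T) (rs : seq T) (w : T) : nat :=
  find (fun r => connect E r w) rs.

(** State of a search: the roots [rs] found so far, the queue [qs] of all visited
    vertices, of which the first [h] have been processed.  All that the completed
    trees can reach is visited ([vis_old]) and the pending vertices belong to the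
    current tree ([vis_new]), so a vertex met now has the current root as the
    first one that reaches it. *)
Record visited (T : finType) (E : rel T) (rs qs : seq T) (h : nat) : Prop :=
  Visited {
    vis_uniq : uniq qs;
    vis_size : h <= size qs;
    vis_reach : forall w, w \in qs -> has (fun r => connect E r w) rs;
    vis_root : {subset rs <= qs};
    vis_old : forall w, has (fun r => connect E r w) (take (size rs).-1 rs) ->
                w \in qs;
    vis_new : forall w, w \in drop h qs -> (first_reach E rs w).+1 = size rs }.

Definition label (T : finType) (E : rel T) (rs qs : seq T) (w : T) : nat :=
  if w \in qs then (first_reach E rs w).+1 else 0.

Lemma visited_closed (T : finType) (E : rel T) (rs qs : seq T) :
  {subset rs <= qs} -> (forall x w, x \in qs -> E x w -> w \in qs) ->
  forall w, has (fun r => connect E r w) rs -> w \in qs.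
Proof.
move=> sub cl w /hasP[r /sub rq /connectP[p rp ->]].
elim: p r rq rp => [|z p IH] r rq //= /andP[rz zp].
exact: IH (cl _ _ rq rz) zp.
Qed.

(** A new neighbour [w] of a vertex [v] of the current tree is reached by the
    current root, and by no earlier root as all that these reach is visited. *)
Lemma first_reach_step (T : finType) (E : rel T) (rs qs : seq T) h v w :
  visited E rs qs h -> (first_reach E rs v).+1 = size rs -> E v w ->
  w \notin qs -> (first_reach E rs w).+1 = size rs.
Proof.
move=> vis vlast vw wq; have [_ _ _ _ old _] := vis.
have sz : 0 < size rs by rewrite -vlast.
case/lastP: rs vlast sz old {vis} => // rs r + _.
rewrite /first_reach size_rcons -cats1 /= !find_cat /=.
have -> : take (size rs) (rs ++ [:: r]) = rs by rewrite take_size_cat.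
move=> vlast old; case: ifP => [/old|_]; first by rewrite (negPf wq).
move: vlast; case: (boolP (has _ rs)) => [|_].
  by rewrite has_find => /[swap] -[->]; rewrite ltnn.
case rv: (connect E r v); last by move=> [/eqP]; rewrite addn1 eqn_leq ltnn.
by rewrite (connect_trans rv (connect1 vw)) addn0.
Qed.

Lemma visited_rcons (T : finType) (E : rel T) (rs qs : seq T) h w :
  visited E rs qs h -> (first_reach E rs w).+1 = size rs -> w \notin qs ->
  visited E rs (rcons qs w) h.
Proof.
move=> [u sz reach root old new] wlast wq; split.
- by rewrite rcons_uniq wq.
- by rewrite size_rcons ltnW.
- move=> x; rewrite mem_rcons inE => /predU1P[->|/reach //].
  by rewrite has_find -/(first_reach E rs w) -wlast.
- by move=> x /root; rewrite mem_rcons inE => ->; rewrite orbT.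
- by move=> x /old; rewrite mem_rcons inE => ->; rewrite orbT.
move=> x; rewrite -cats1 drop_cat; case: ltnP => hq.
  by rewrite mem_cat inE => /orP[/new //|/eqP ->].
rewrite (_ : h - size qs = 0); first by rewrite drop0 inE => /eqP ->.
by apply/eqP; rewrite subn_eq0 sz.
Qed.

Lemma visited_pop (T : finType) (E : rel T) (rs qs : seq T) h :
  visited E rs qs h -> h < size qs -> visited E rs qs h.+1.
Proof.
move=> [u sz reach root old new] hq; split=> // w wd; apply: new.
by rewrite (drop_nth w hq) inE wd orbT.
Qed.

(** When the queue is exhausted, the visited set is closed under edges: it is all
    that the roots reach, so an unvisited candidate is a new greedy root. *)
Lemma visited_root (T : finType) (E : rel T) (rs qs : seq T) r :
  visited E rs qs (size qs) ->
  (forall x w, x \in qs -> E x w -> w \in qs) -> r \notin qs ->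
  [/\ ~~ has (fun r' => connect E r' r) rs,
      visited E (rcons rs r) (rcons qs r) (size qs) &
      forall w, label E (rcons rs r) (rcons qs r) w =
        if w == r then (size rs).+1 else label E rs qs w].
Proof.
move=> [u _ reach root old _] cl rq.
have nr : ~~ has (fun r' => connect E r' r) rs.
  by apply: contra rq; apply: visited_closed root cl _.
have find_r : first_reach E (rcons rs r) r = size rs.
  by rewrite /first_reach -cats1 find_cat (negPf nr) /= connect0 addn0.
split=> //; last first.
  move=> w; rewrite /label mem_rcons inE; case: eqP => [->|wr] /=.
    by rewrite find_r.
  case: ifP => // wq; congr _.+1.
  by rewrite /first_reach -cats1 find_cat reach.
split.
- by rewrite rcons_uniq rq.
- by rewrite size_rcons.
- move=> w; rewrite mem_rcons inE has_rcons => /predU1P[->|/reach ->].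
    by rewrite connect0.
  exact: orbT.
- move=> w; rewrite !mem_rcons !inE => /predU1P[->|/root ->]; first by rewrite eqxx.
  exact: orbT.
- move=> w; rewrite size_rcons -cats1 take_size_cat //= => h.
  by rewrite mem_rcons inE (visited_closed root cl h) orbT.
- move=> w; rewrite -cats1 drop_size_cat // inE => /eqP ->.
  by rewrite size_rcons find_r.
Qed.

(** ** The search program *)

Definition nop : cmd := SetReg 31 (Cst 0).

Definition edge_expr (forward : bool) : expr :=
  if forward then Get 0 (Reg 10) (Reg 9) else Get 0 (Reg 9) (Reg 10).

(** Array 2 holds the labels, array 6 the queue, array 7 the roots and array 8
    the candidates; register 5 counts the candidates that are left, registers 6
    and 7 delimit the unprocessed part of the queue, register 8 counts the roots. *)
Definition visit (e : expr) : cmd :=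
  Seq (Put 2 (Cst 0) e (Reg 8))
      (Seq (Put 6 (Cst 0) (Reg 7) e) (SetReg 7 (Succ (Reg 7)))).

Definition scan (forward : bool) : cmd :=
  If (edge_expr forward)
     (If (Get 2 (Cst 0) (Reg 10)) nop (visit (Reg 10))) nop.

Definition pop : cmd :=
  Seq (SetReg 9 (Get 6 (Cst 0) (Reg 6))) (SetReg 6 (Succ (Reg 6))).

Definition next_candidate : cmd :=
  Seq (SetReg 5 (Pred (Reg 5)))
 (Seq (SetReg 9 (Get 8 (Cst 0) (Reg 5)))
      (If (Get 2 (Cst 0) (Reg 9)) nop
          (Seq (Put 7 (Cst 0) (Reg 8) (Reg 9))
          (Seq (SetReg 8 (Succ (Reg 8))) (visit (Reg 9)))))).

(** The queue is not exhausted or a candidate is left: [b <= c] with [b] the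
    negation of the first condition, as a number, and [c] the count of
    candidates. *)
Definition pending : expr :=
  Lt (Eq (Lt (Reg 6) (Reg 7)) (Cst 0)) (Succ (Reg 5)).

Definition search_loop (forward : bool) : cmd :=
  While pending
    (If (Lt (Reg 6) (Reg 7)) (Seq pop (For 10 0 (scan forward))) next_candidate).

Definition search (forward : bool) : cmd :=
  Seq (SetReg 6 (Cst 0)) (Seq (SetReg 7 (Cst 0)) (Seq (SetReg 8 (Cst 0))
    (search_loop forward))).

Section Search.
Variables (R : realType) (n : nat) (A : 'M[bool]_n) (forward : bool).
Variable cs : seq 'I_n.
Implicit Types (s : state R).

Let E : rel 'I_n := fun v w => if forward then A w v else A v w.

Definition holds s (a : nat) (l : seq 'I_n) : Prop :=
  forall i : nat, forall x, onth l i = Some x -> arr s a 0 i = x.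

Lemma bool_cellE p q (M : 'M[bool]_(p, q)) (i : 'I_p) (j : 'I_q) :
  bool_cell M i j = M i j.
Proof. by rewrite /bool_cell !valK. Qed.

(** Candidates are consumed from the end of [cs], so the roots found are greedy for
    the reversal of the suffix already consumed. *)
Record search_env s (i h : nat) (rs qs : seq 'I_n) : Prop := SearchEnv {
  se_n : reg s 0 = n;
  se_i : reg s 5 = i;
  se_h : reg s 6 = h;
  se_t : reg s 7 = size qs;
  se_r : reg s 8 = size rs;
  se_A : forall k l, arr s 0 k l = bool_cell A k l;
  se_cs : holds s 8 cs;
  se_rs : holds s 7 rs;
  se_qs : holds s 6 qs;
  se_lab : forall w : 'I_n, arr s 2 0 w = label E rs qs w;
  se_greedy : rs = greedy E (rev (drop i cs));
  se_left : i <= size cs;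
  se_vis : visited E rs qs h }.

Lemma holds_rcons s s' a l (x : 'I_n) :
  holds s a l -> (forall i, i != size l -> arr s' a 0 i = arr s a 0 i) ->
  arr s' a 0 (size l) = x -> holds s' a (rcons l x).
Proof.
move=> hl eq_s lx i y; rewrite onthE map_rcons nth_rcons size_map.
have [il|il|->] := ltngtP i (size l).
- by rewrite -onthE => /hl <-; apply: eq_s; rewrite ltn_eqF.
- by [].
- by case=> <-.
Qed.

Lemma scan_runs s i h rs qs (v w : 'I_n) :
  search_env s i h rs qs -> reg s 9 = v -> reg s 10 = w ->
  (first_reach E rs v).+1 = size rs ->
  runs s (scan forward) (time (scan forward)) (fun s' =>
    exists qs', [/\ search_env s' i h rs qs', reg s' 9 = v,
      {subset qs <= qs'}, take h qs' = take h qs & (E v w -> w \in qs')]).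
Proof.
move=> env vE wE vlast; have [e0 e5 e6 e7 e8 eA ec er eq el eg le vis] := env.
apply: wp_runs.
have edgeE : eval s (edge_expr forward) = E v w.
  by rewrite /E; case: forward; rewrite /= vE wE eA bool_cellE.
split=> [|noE]; last first.
  exists qs; split=> //.
  by move: noE; rewrite edgeE; case: (E v w).
rewrite edgeE eqb0 negbK => vw; split=> /=; rewrite wE el /label.
  by case: ifP => // wq _; exists qs; split.
case: ifP => // /negbT wq _.
have wlast := first_reach_step vis vlast vw wq.
exists (rcons qs w); split=> //=; last first.
- by rewrite mem_rcons inE eqxx.
- rewrite -cats1 take_cat; case: ltnP => // hq.
  have -> : h = size qs by apply/eqP; rewrite eqn_leq hq (vis_size vis).
  by rewrite subnn take0 cats0 take_size.
- by move=> x xq; rewrite mem_rcons inE xq orbT.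
split=> //=.
- by rewrite e7 size_rcons.
- apply: holds_rcons eq _ _ => /= [k kq|]; first by rewrite e7 (negPf kq).
  by rewrite e7 eqxx.
- move=> x; rewrite /label mem_rcons inE -!val_eqE /=.
  case: eqP => [xw|_] /=; last by rewrite el.
  by rewrite e8 -wlast; congr (first_reach E rs _).+1; apply: val_inj.
- exact: visited_rcons.
Qed.

Definition processed (qs : seq 'I_n) h : Prop :=
  forall x w, x \in take h qs -> E x w -> w \in qs.

Definition pop_time : nat := time pop + for_time n (time (scan forward)).

(** The inner loop scans the out-neighbours of the vertex [v] just popped; among
    the first [h.+1] vertices of the queue, only [v] may still have unvisited
    ones. *)
Lemma pop_runs s i h rs qs :
  search_env s i h rs qs -> h < size qs -> processed qs h ->
  runs s (Seq pop (For 10 0 (scan forward))) pop_time (fun s' =>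
    exists qs', search_env s' i h.+1 rs qs' /\ processed qs' h.+1).
Proof.
move=> env hq proc; have [e0 e5 e6 e7 e8 eA ec er eq el eg le vis] := env.
have [v qv] : exists v, onth qs h = Some v.
  by have := hq; rewrite -onthTE; case: (onth qs h) => // v _; exists v.
have vE : nth v qs h = v := onth_nth _ _ _ _ qv.
have vlast : (first_reach E rs v).+1 = size rs.
  by apply: (vis_new vis); rewrite (drop_nth v hq) vE mem_head.
have take_v : take h.+1 qs = rcons (take h qs) v by rewrite (take_nth v hq) vE.
apply: runs_seq; apply: wp_runs => /=.
rewrite e6 (eq _ _ qv).
pose I k s1 := exists qs', [/\ search_env s1 i h.+1 rs qs', reg s1 9 = v,
  {subset qs <= qs'}, take h.+1 qs' = take h.+1 qs &
  forall w : 'I_n, w < k -> E v w -> w \in qs'].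
apply: runs_le (@runs_for _ 10 0 (scan forward) (time (scan forward)) n I
  _ _ _ _ _ _ _) (leqnn _) _ => //=.
- exists qs; split=> //; split=> //=; exact: visited_pop.
- move=> k s1 kn [qs1 [env1 v1 sub1 take1 nb1]] s1k.
  apply: runs_le (@scan_runs s1 _ _ _ _ v (Ordinal kn) env1 v1 s1k vlast)
    (leqnn _) _ => s2 [qs2 [env2 v2 sub2 take2 nb2]].
  exists qs2; split=> //.
  + by case: env2 => *; split.
  + by move=> x /sub1/sub2.
  + by rewrite take2.
  move=> w; rewrite ltnS leq_eqVlt => /orP[/eqP wk|wk vw]; last first.
    exact/sub2/nb1.
  by have -> : w = Ordinal kn by apply: val_inj.
move=> s1 [qs1 [env1 _ sub1 take1 nb1]]; exists qs1; split=> // x w.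
rewrite take1 take_v mem_rcons inE => /predU1P[->|xq]; first exact: nb1.
by move/(proc _ _ xq)/sub1.
Qed.

Lemma next_candidate_runs s i h rs qs :
  search_env s i h rs qs -> size qs <= h -> processed qs h -> 0 < i ->
  runs s next_candidate (time next_candidate) (fun s' =>
    exists rs' qs', search_env s' i.-1 h rs' qs' /\ processed qs' h).
Proof.
move=> env qh proc i0; have [e0 e5 e6 e7 e8 eA ec er eq el eg le vis] := env.
have hE : h = size qs by apply/eqP; rewrite eqn_leq qh (vis_size vis).
have cl x w : x \in qs -> E x w -> w \in qs.
  by move: (proc x w); rewrite hE take_size.
have lt : i.-1 < size cs by rewrite prednK.
have [r cr] : exists r, onth cs i.-1 = Some r.
  by have := lt; rewrite -onthTE; case: (onth cs i.-1) => // r _; exists r.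
have drop_r : rev (drop i.-1 cs) = rcons (rev (drop i cs)) r.
  by rewrite (drop_nth r lt) prednK // (onth_nth _ _ _ _ cr) rev_cons.
apply: wp_runs => /=; rewrite e5 (ec _ _ cr) el /label.
split; case: ifP => // rq _.
  exists rs, qs; split=> //; split=> //=.
    by rewrite drop_r greedy_rcons -eg (vis_reach vis).
  by rewrite ltnW.
rewrite hE in vis; have nrq := negbT rq.
have [nr vis' labE] := visited_root vis cl nrq.
exists (rcons rs r), (rcons qs r); split; last first.
  move=> x w; rewrite hE -cats1 take_size_cat // => xq /(cl _ _ xq) wq.
  by rewrite mem_cat wq.
split=> //=.
- by rewrite e7 size_rcons.
- by rewrite e8 size_rcons.
- apply: holds_rcons er _ _ => /= [k kq|]; first by rewrite e8 (negPf kq).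
  by rewrite e8 eqxx.
- apply: holds_rcons eq _ _ => /= [k kq|]; first by rewrite e7 (negPf kq).
  by rewrite e7 eqxx.
- by move=> w; rewrite labE -val_eqE /= e8 el; case: eqP.
- by rewrite drop_r greedy_rcons -eg (negPf nr).
- by rewrite ltnW.
- by rewrite hE.
Qed.

Definition reach_label (rs : seq 'I_n) (w : 'I_n) : nat :=
  if has (fun r => connect E r w) rs then (first_reach E rs w).+1 else 0.

Definition search_time : nat :=
  2 + (2 + (2 + ((n + n) * ((steps pending).+1 +
         ((steps (Lt (Reg 6) (Reg 7))).+1 + maxn pop_time (time next_candidate)))
       + (steps pending).+1))).

Record found s (rs : seq 'I_n) : Prop := Found {
  found_size : reg s 8 = size rs;
  found_holds : holds s 7 rs;
  found_label : forall w : 'I_n, arr s 2 0 w = reach_label rs w }.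

(** Each round processes a vertex of the queue or consumes a candidate, which
    happens at most [n] times each. *)
Lemma search_runs s :
  reg s 0 = n -> reg s 5 = size cs -> size cs <= n ->
  (forall k l, arr s 0 k l = bool_cell A k l) -> holds s 8 cs ->
  (forall w : 'I_n, arr s 2 0 w = 0) ->
  runs s (search forward) search_time (fun s' => found s' (greedy E (rev cs))).
Proof.
move=> e0 e5 csn eA ec el.
do 3!(apply: runs_seq; apply: (@wp_runs _ (SetReg _ _)) => /=).
pose J s1 := exists i h rs qs, search_env s1 i h rs qs /\ processed qs h.
pose mu s1 := n - reg s1 6 + reg s1 5.
set s0 := set_reg _ _ _.
have J0 : J s0.
  exists (size cs), 0, [::], [::]; split=> //; split=> //=.
  - by move=> i x; rewrite onth0n.
  - by move=> i x; rewrite onth0n.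
  - by rewrite drop_size.
apply: runs_le (@runs_while _ _ _ _ J mu s0 J0 _) _ _.
- move=> s1 [i [h [rs [qs [env proc]]]]] pend.
  have [e0' e5' e6' e7' e8' _ _ _ _ _ _ _ vis] := env.
  apply: runs_if; rewrite /= e6' e7'; [rewrite eqb0 negbK => hq
    | move/eqP; rewrite eqb0 -leqNgt => hq].
    apply: runs_le (runs_same (pop_runs env hq proc)) (leqnn _) _.
    move=> s2 [[qs' [env' proc']] _]; split; first by exists i, h.+1, rs, qs'.
    rewrite /mu (se_h env') (se_i env') e5' e6' ltn_add2r ltn_sub2l //.
    apply: leq_trans hq _; rewrite -(card_uniqP (vis_uniq vis)).
    by apply: leq_trans (max_card _) _; rewrite card_ord.
  have i0 : 0 < i.
    by move: pend; rewrite /= e6' e7' e5' [h < _]ltnNge hq eqb0 negbK ltnS.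
  apply: runs_le (next_candidate_runs env hq proc i0) (leqnn _) _.
  move=> s2 [rs' [qs' [env' proc']]]; split; first by exists i.-1, h, rs', qs'.
  by rewrite /mu (se_h env') (se_i env') e5' e6' ltn_add2l prednK.
- rewrite leq_add2r leq_mul //.
  by rewrite /mu /= subn0 e5 leq_add2l.
move=> s1 [[i [h [rs [qs [env proc]]]]] done].
have [e0' e5' e6' e7' e8' _ _ er _ el' eg _ vis] := env.
move: done => /=; rewrite e6' e7' e5' ltnNge.
case: (leqP (size qs) h) => //= qh; case: i eg {env e5'} => // eg _.
have hE : h = size qs by apply/eqP; rewrite eqn_leq qh (vis_size vis).
have cl x w : x \in qs -> E x w -> w \in qs.
  by move: (proc x w); rewrite hE take_size.
have <- : rs = greedy E (rev cs) by rewrite eg drop0.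
split=> // w; rewrite el' /label /reach_label; congr (if _ then _ else _).
by apply/idP/idP => [/(vis_reach vis)|/(visited_closed (vis_root vis) cl)].
Qed.

(** ** Chaining searches *)

(** The roots found become the candidates of the next search. *)
Definition reset_cell : cmd :=
  Seq (Put 8 (Cst 0) (Reg 10) (Get 7 (Cst 0) (Reg 10)))
      (Put 2 (Cst 0) (Reg 10) (Cst 0)).

Definition stage : cmd :=
  Seq (For 10 0 reset_cell) (Seq (SetReg 5 (Reg 8)) (search forward)).

Definition stage_time : nat := for_time n (time reset_cell) + (2 + search_time).

Record candidates s (l : seq 'I_n) : Prop := Candidates {
  cand_n : reg s 0 = n;
  cand_A : forall k l, arr s 0 k l = bool_cell A k l;
  cand_size : reg s 8 = size l;
  cand_le : size l <= n;
  cand_holds : holds s 7 l }.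

Lemma stage_runs s : candidates s cs ->
  runs s stage stage_time (fun s' => found s' (greedy E (rev cs))).
Proof.
move=> [e0 eA e8 csn er]; apply: runs_seq.
pose I k s1 := candidates s1 cs /\
  forall j, j < k -> arr s1 8 0 j = arr s1 7 0 j /\ arr s1 2 0 j = 0.
apply: runs_le (@runs_for _ 10 0 reset_cell (time reset_cell) n I
  _ _ _ _ _ _ _) (leqnn _) _ => //=.
- move=> k s1 kn [[f0 fA f8 _ fr] done] s1k; apply: wp_runs => /=.
  split=> //= j; rewrite ltnS leq_eqVlt s1k => /predU1P[->|jk].
    by rewrite eqxx.
  by rewrite (ltn_eqF jk); apply: done.
move=> s1 [[f0 fA f8 _ fr] done]; apply: runs_seq.
apply: (@wp_runs _ (SetReg _ _)) => /=; apply: search_runs => //=.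
  move=> i x ix; rewrite (done i _).1 ?(fr _ _ ix) //.
  by apply: leq_trans csn; rewrite -onthTE ix.
by move=> w; rewrite (done w _).2.
Qed.
End Search.

(** * Three searches find the non-top linked components *)

Lemma pairwise_rev (T : Type) (r : rel T) s :
  pairwise r (rev s) = pairwise (fun x y => r y x) s.
Proof.
by elim: s => //= x s IH; rewrite rev_cons pairwise_rcons IH all_rev.
Qed.

Section Representatives.
Variables (n : nat) (A : 'M[bool]_n).
Let e : rel 'I_n := fun v w => A w v.
Let e' : rel 'I_n := fun v w => A v w.

Lemma connect_backward x y : connect e' x y = connect e y x.
Proof. by rewrite (connect_rev e). Qed.

Definition ntl_roots : seq 'I_n :=
  greedy e' (rev (greedy e (rev (greedy e (rev (enum 'I_n)))))).

Definition incomparable (rs : seq 'I_n) : Prop :=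
  forall r r', r \in rs -> r' \in rs -> connect e r r' -> r = r'.

(** The first search keeps roots that no earlier one reaches; the second runs
    through them backwards and discards those that a later one reaches.  Hence the
    remaining roots do not reach each other, although together they reach every
    vertex. *)
Lemma two_searches (rs := greedy e (rev (greedy e (rev (enum 'I_n))))) :
  [/\ uniq rs, incomparable rs & forall x, exists2 r, r \in rs & connect e r x].
Proof.
set rs1 := greedy e (rev (enum 'I_n)) in rs *.
have u1 : uniq rs1.
  by apply: subseq_uniq (greedy_subseq _ _) _; rewrite rev_uniq enum_uniq.
have sub2 : subseq rs (rev rs1) := greedy_subseq _ _.
have u2 : uniq rs by apply: subseq_uniq sub2 _; rewrite rev_uniq.
split=> // [r r' rin r'in rr'|x]; last first.
  have [|r rin rx] := @greedy_reach _ e (rev (enum 'I_n)) x.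
    by rewrite mem_rev mem_enum.
  have [|r' r'in r'r] := @greedy_reach _ e (rev rs1) r; first by rewrite mem_rev.
  by exists r' => //; apply: connect_trans r'r rx.
have p2 : pairwise (fun x y => ~~ connect e x y) rs := greedy_pairwise _ _.
have p1 : pairwise (fun x y => ~~ connect e y x) rs.
  apply: subseq_pairwise sub2 _.
  by rewrite pairwise_rev; apply: greedy_pairwise.
have both : pairwise (fun x y => ~~ connect e x y && ~~ connect e y x) rs.
  by rewrite pairwise_relI p2 p1.
apply/eqP; apply: contraTT rr' => neq.
have sz x : x \in rs -> index x rs < size rs by rewrite index_mem.
have [lt|lt|eq] := ltngtP (index r rs) (index r' rs).
- have /(pairwiseP r)/(_ _ _ (sz _ rin) (sz _ r'in) lt) := both.
  by rewrite !nth_index // => /andP[].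
- have /(pairwiseP r)/(_ _ _ (sz _ r'in) (sz _ rin) lt) := both.
  by rewrite !nth_index // => /andP[].
by case/eqP: neq; rewrite -(nth_index r rin) eq nth_index.
Qed.

(** The third search, along reversed edges, keeps all these roots as they do not
    reach each other; it serves to label their ancestors. *)
Lemma ntl_roots_props :
  [/\ uniq ntl_roots, incomparable ntl_roots &
      forall x, exists2 r, r \in ntl_roots & connect e r x].
Proof.
have [u inc reach] := two_searches; rewrite /ntl_roots.
set rs := greedy e _ in u inc reach *.
have sub : subseq (greedy e' (rev rs)) (rev rs) := greedy_subseq _ _.
have mem3 : greedy e' (rev rs) =i rs.
  move=> x; apply/idP/idP => [/(mem_subseq sub)|xin]; first by rewrite mem_rev.
  have [|r rin] := @greedy_reach _ e' (rev rs) x; first by rewrite mem_rev.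
  rewrite connect_backward => xr; rewrite (inc x r) //.
  by have := mem_subseq sub rin; rewrite mem_rev.
split=> [|r r'|x]; first by apply: subseq_uniq sub _; rewrite rev_uniq.
  by rewrite !mem3; apply: inc.
by have [r rin rx] := reach x; exists r; rewrite ?mem3.
Qed.

Lemma mem_scc x y : (y \in scc_of A x) = connect e x y && connect e y x.
Proof. by rewrite inE. Qed.

Lemma scc_eq x y : y \in scc_of A x -> scc_of A y = scc_of A x.
Proof.
rewrite mem_scc => /andP[xy yx]; apply/setP => z; rewrite !mem_scc.
apply/andP/andP => -[h1 h2].
  by rewrite (connect_trans xy h1) (connect_trans h2 yx).
by rewrite (connect_trans yx h1) (connect_trans h2 xy).
Qed.

(** Whatever reaches such a root is in its component: it is itself reached by
    some root, which can only be the same one. *)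
Lemma root_ancestor r x : r \in ntl_roots -> connect e x r -> x \in scc_of A r.
Proof.
have [_ inc reach] := ntl_roots_props; move=> rin xr; rewrite mem_scc xr andbT.
have [r' r'in r'x] := reach x.
by rewrite -(inc r' r) // (connect_trans r'x xr).
Qed.

Lemma root_scc r : r \in ntl_roots -> scc_of A r \in ntl_sccs A.
Proof.
move=> rin; rewrite inE imset_f //=; apply/forallP => M; apply/implyP => Mscc.
apply/implyP => neq; apply/forallP => x; apply/implyP => xM; apply/forallP => y.
apply/implyP; rewrite mem_scc => /andP[_ yr]; apply/negP => xy.
have xr := root_ancestor rin (connect_trans (connect1 (xy : e x y)) yr).
case/imsetP: Mscc => z _ Mz; case/eqP: neq.
by rewrite -(scc_eq xr) Mz; rewrite Mz in xM; rewrite (scc_eq xM).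
Qed.

Lemma ntl_has_root N : N \in ntl_sccs A ->
  exists2 r, r \in ntl_roots & N = scc_of A r.
Proof.
rewrite inE => /andP[/imsetP[x _ Nx] ntl].
have [_ _ reach] := ntl_roots_props; have [r rin rx] := reach x.
suff rN : r \in N by exists r => //; rewrite Nx (@scc_eq x r) // -Nx.
have back u v : e u v -> v \in N -> u \in N.
  move=> uv vN; apply/negPn/negP => uN; move/forallP/(_ (scc_of A u)): ntl.
  have uu : u \in scc_of A u by rewrite mem_scc !connect0.
  rewrite imset_f //= => /implyP; case: eqP => [E|_ /(_ isT)].
    by rewrite -E uu in uN.
  move/forallP/(_ u)/implyP/(_ uu)/forallP/(_ v)/implyP/(_ vN).
  by rewrite /state_edge -/(e u v) uv.
have xN : x \in N by rewrite Nx mem_scc !connect0.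
case/connectP: rx => p rp xE; subst x; move: xN; rewrite {Nx}.
elim: p r rp {rin} => //= y p IH r /andP[ry yp] /(IH y yp).
exact: back.
Qed.

Lemma size_ntl_roots : size ntl_roots = ntl_count A.
Proof.
have [u inc _] := ntl_roots_props.
rewrite -(size_map (scc_of A)) /ntl_count; apply/esym.
have um : uniq (map (scc_of A) ntl_roots).
  rewrite map_inj_in_uniq // => r r' rin r'in E; apply: inc => //.
  have : r' \in scc_of A r by rewrite E mem_scc !connect0.
  by rewrite mem_scc => /andP[].
rewrite -(card_uniqP um); apply: eq_card => N; apply/idP/mapP => [|[r rin ->]].
  by move/ntl_has_root => [r rin ->]; exists r.
exact: root_scc.
Qed.

Lemma ntl_count_le : ntl_count A <= n.
Proof.
have [u _ _] := ntl_roots_props.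
by rewrite -size_ntl_roots -(card_uniqP u) (leq_trans (max_card _)) ?card_ord.
Qed.

(** ** Numbering of the components *)

Definition root_of (i : 'I_(ntl_count A)) : 'I_n :=
  tnth (in_tuple ntl_roots) (cast_ord (esym size_ntl_roots) i).

Lemma root_of_mem i : root_of i \in ntl_roots.
Proof. exact: mem_tnth. Qed.

Definition scc_at (i : 'I_(ntl_count A)) : ntl_scc A :=
  exist _ (scc_of A (root_of i)) (root_scc (root_of_mem i)).

Lemma root_of_connect i j : connect e (root_of i) (root_of j) -> i = j.
Proof.
have [u inc _] := ntl_roots_props.
move/(inc _ _ (root_of_mem i) (root_of_mem j)).
move/(tuple_uniqP (in_tuple ntl_roots) u) => /(congr1 val) /= ij.
exact: val_inj.
Qed.

Lemma scc_at_inj : injective scc_at.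
Proof.
move=> i j /(congr1 val) /= E; apply: root_of_connect.
have : root_of j \in scc_of A (root_of i) by rewrite E mem_scc !connect0.
by rewrite mem_scc => /andP[].
Qed.

Lemma scc_at_bij : bijective scc_at.
Proof. by apply: inj_card_bij scc_at_inj _; rewrite card_sig card_ord. Qed.

Lemma root_label (i : 'I_(ntl_count A)) w : w \in scc_of A (root_of i) ->
  reach_label A false ntl_roots w = i.+1.
Proof.
have [u inc _] := ntl_roots_props; rewrite mem_scc => /andP[iw wi].
have rE : nth (root_of i) ntl_roots i = root_of i.
  by rewrite {2}/root_of (tnth_nth (root_of i)).
have hw : has (fun r => connect e' r w) ntl_roots.
  by apply/hasP; exists (root_of i); rewrite ?root_of_mem ?connect_backward.
rewrite /reach_label hw; congr _.+1; rewrite /first_reach; set j := find _ _.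
have jlt : j < size ntl_roots by rewrite -has_find.
have := nth_find (root_of i) hw; rewrite connect_backward => wj.
apply/eqP; rewrite -(nth_uniq (root_of i) jlt _ u) ?size_ntl_roots // rE.
apply/eqP/esym/inc; rewrite ?root_of_mem ?mem_nth //.
exact: connect_trans iw wj.
Qed.

Lemma no_root_label w : (forall i, w \notin scc_of A (root_of i)) ->
  reach_label A false ntl_roots w = 0.
Proof.
move=> out; rewrite /reach_label; case: ifP => // /hasP[r rin].
rewrite connect_backward => /(root_ancestor rin) wr.
have ilt : index r ntl_roots < ntl_count A by rewrite -size_ntl_roots index_mem.
have /negP[] := out (Ordinal ilt).
by rewrite /root_of (tnth_nth r) /= nth_index.
Qed.
End Representatives.

(** ** The program that finds the components *)

Definition find_roots : cmd :=
  Seq (Seq (For 10 0 (Put 7 (Cst 0) (Reg 10) (Reg 10))) (SetReg 8 (Reg 0)))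
 (Seq (stage true) (Seq (stage true) (Seq (stage false) (SetReg 2 (Reg 8))))).

Definition find_roots_time n : nat :=
  for_time n (time (Put 7 (Cst 0) (Reg 10) (Reg 10))) + 2 +
  (stage_time n true + (stage_time n true + (stage_time n false + 2))).

Lemma found_candidates (R : realType) n (A : 'M[bool]_n) forward (s s' : state R)
    (l rs : seq 'I_n) :
  candidates A s l -> same (stage forward) s s' -> found A forward s' rs ->
  uniq rs -> candidates A s' rs.
Proof.
move=> [e0 eA _ _ _] [r a _] [f8 f7 _] u; split=> //.
- by rewrite r //; case: forward.
- by move=> k m; rewrite a //; case: forward.
by rewrite -(card_uniqP u) (leq_trans (max_card _)) ?card_ord.
Qed.

Lemma greedy_uniq (T : finType) (E : rel T) cs : uniq cs -> uniq (greedy E cs).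
Proof. exact: subseq_uniq (greedy_subseq _ _). Qed.

Lemma find_roots_runs (R : realType) n m (A : 'M[bool]_n) (B : 'M[bool]_(n, m))
    (pu : 'I_m -> R) :
  runs (input_state A B pu) find_roots (find_roots_time n) (fun s =>
    reg s 2 = ntl_count A /\
    forall w : 'I_n, arr s 2 0 w = reach_label A false (ntl_roots A) w).
Proof.
apply: runs_seq.
have init : runs (input_state A B pu)
    (Seq (For 10 0 (Put 7 (Cst 0) (Reg 10) (Reg 10))) (SetReg 8 (Reg 0)))
    (for_time n (time (Put 7 (Cst 0) (Reg 10) (Reg 10))) + 2)
    (fun s => candidates A s (enum 'I_n)).
  apply: runs_seq.
  pose I k (s : state R) := [/\ reg s 0 = n,
    forall i j, arr s 0 i j = bool_cell A i j & forall i, i < k -> arr s 7 0 i = i].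
  apply: runs_le (@runs_for _ 10 0 _ (time _) n I _ _ _ _ _ _ _) (leqnn _) _ => //=.
    move=> k s kn [e0 eA e7] sk.
    apply: (@wp_runs _ (Put 7 (Cst 0) (Reg 10) (Reg 10))) => /=.
    split=> //= i; rewrite ltnS leq_eqVlt sk => /predU1P[->|ik].
      by rewrite eqxx.
    by rewrite (ltn_eqF ik) e7.
  move=> s [e0 eA e7]; apply: (@wp_runs _ (SetReg 8 (Reg 0))) => /=.
  split; rewrite /= ?size_enum_ord //.
  move=> i x ix; have ilt : i < n by rewrite -(size_enum_ord n) -onthTE ix.
  by rewrite /= e7 // -(onth_nth x _ _ _ ix) nth_enum_ord.
apply: runs_le init (leqnn _) _ => s1 c1; apply: runs_seq.
apply: runs_le (runs_same (stage_runs true c1)) (leqnn _) _ => s2 [f2 same2].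
have u0 := enum_uniq 'I_n.
have u1 : uniq (greedy (fun v w => A w v) (rev (enum 'I_n))).
  by rewrite greedy_uniq // rev_uniq.
have c2 := found_candidates c1 same2 f2 u1; apply: runs_seq.
apply: runs_le (runs_same (stage_runs true c2)) (leqnn _) _ => s3 [f3 same3].
have u2 : uniq (greedy (fun v w => A w v)
    (rev (greedy (fun v w => A w v) (rev (enum 'I_n))))).
  by rewrite greedy_uniq // rev_uniq.
have c3 := found_candidates c2 same3 f3 u2; apply: runs_seq.
apply: runs_le (stage_runs false c3) (leqnn _) _ => s4 [f8 _ flab].
apply: (@wp_runs _ (SetReg 2 (Reg 8))) => /=; split; last exact: flab.
by rewrite f8 -size_ntl_roots.
Qed.

(** * Programs that list *)

Section Emission.
Variable R : realType.
Implicit Types (s : state R) (P : state R -> Prop).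

Definition stable P c : Prop := forall s s', P s -> same c s s' -> P s'.

Lemma stable_reg P c x v :
  stable P c -> ~~ writes_reg x c -> stable (fun s => P s /\ reg s x = v) c.
Proof.
move=> st xc s s' [Ps xs] sm; split; first exact: st sm.
by have [r _ _] := sm; rewrite r.
Qed.

Lemma same_set_reg s x v lim c : same (For x lim c) s (set_reg s x v).
Proof. by split=> // y /=; rewrite negb_or => /andP[/negPf ->]. Qed.

Lemma same_body s s' x lim c : same c s s' -> same (For x lim c) s s'.
Proof.
move=> [r a k]; split=> [y|b i j|b i] /=; rewrite ?orbF; auto.
by rewrite !negb_or => /andP[_ /andP[h _]]; apply: r.
Qed.

Variables (X Y : Type) (out : state R -> seq Y) (code : X -> Y) (counter : nat).
Hypothesis out_set_reg : forall s x v, x != counter -> out (set_reg s x v) = out s.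

Definition emits P c T (L : seq X) : Prop :=
  forall s, P s -> runs s c T (fun s' => out s' = out s ++ map code L).

Lemma emits_seq P c1 c2 T1 T2 L1 L2 :
  emits P c1 T1 L1 -> stable P c1 -> emits P c2 T2 L2 ->
  emits P (Seq c1 c2) (T1 + T2) (L1 ++ L2).
Proof.
move=> h1 st h2 s Ps; apply: runs_seq.
apply: runs_le (runs_same (h1 s Ps)) (leqnn _) _ => s1 [o1 sm].
apply: runs_le (h2 s1 (st _ _ Ps sm)) (leqnn _) _ => s2 ->.
by rewrite o1 map_cat catA.
Qed.

Lemma emits_if P e c T L (b : bool) :
  31 != counter -> (forall s, P s -> (eval s e != 0) = b) -> emits P c T L ->
  emits P (If e c nop) ((steps e).+1 + maxn T 2) (if b then L else [::]).
Proof.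
move=> c31 eE h s Ps; apply: runs_if => e0.
  by have := eE s Ps; rewrite e0 => <-; apply: h.
have := eE s Ps; rewrite e0 /= => <-; apply: (@wp_runs _ nop) => /=.
by rewrite out_set_reg // cats0.
Qed.

Lemma for_time_le N N' T : N <= N' -> for_time N T <= for_time N' T.
Proof. by move=> le; rewrite /for_time leq_add2l leq_add2r leq_mul2r le orbT. Qed.

Lemma emits_for P x lim c T N N' (L : 'I_N -> seq X) :
  x != lim -> ~~ writes_reg x c -> ~~ writes_reg lim c -> x != counter ->
  N <= N' -> (forall s, P s -> reg s lim = N) -> stable P (For x lim c) ->
  (forall i : 'I_N, emits (fun s => P s /\ reg s x = i) c T (L i)) ->
  emits P (For x lim c) (for_time N' T) (flatten [seq L i | i <- enum 'I_N]).
Proof.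
move=> xlim xc limc xcnt le limE st h s Ps.
pose I k s1 := P s1 /\
  out s1 = out s ++ map code (flatten [seq L i | i <- take k (enum 'I_N)]).
apply: runs_le (@runs_for _ x lim c T N I s xlim xc limc (limE s Ps) _ _)
  (for_time_le _ le) _.
- split; first exact: st Ps (same_set_reg _ _ _ _ _).
  by rewrite out_set_reg // take0 cats0.
- move=> k s1 kN [Ps1 out1] s1k.
  apply: runs_le (runs_same (h (Ordinal kN) s1 (conj Ps1 s1k))) (leqnn _) _.
  move=> s2 [out2 sm]; split.
    have Ps2 : P s2 := st _ _ Ps1 (same_body _ _ sm).
    exact: st Ps2 (same_set_reg _ _ _ _ _).
  rewrite out_set_reg // out2 out1 (take_nth (Ordinal kN)) ?size_enum_ord //.
  rewrite map_rcons flatten_rcons map_cat catA; congr (_ ++ map code (L _)).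
  by apply: val_inj; rewrite /= nth_enum_ord.
by move=> s1 [_ ->]; rewrite take_oversize // size_enum_ord.
Qed.
End Emission.

(** ** Lists described by loops *)

Definition loop1 (X : Type) (I : finType) (h : I -> X) : seq X :=
  flatten [seq [:: h i] | i <- enum I].

Definition loop2 (X : Type) (I J : finType) (P : I -> J -> bool) (h : I -> J -> X)
    : seq X :=
  flatten [seq flatten [seq if P i j then [:: h i j] else [::] | j <- enum J]
          | i <- enum I].

Lemma mem_loop1 (X : eqType) (I : finType) (h : I -> X) x :
  x \in loop1 h -> exists i, x = h i.
Proof. by case/flatten_mapP => i _; rewrite inE => /eqP ->; exists i. Qed.

Lemma loop1_mem (X : eqType) (I : finType) (h : I -> X) i : h i \in loop1 h.
Proof. by apply/flatten_mapP; exists i; rewrite ?mem_enum ?mem_head. Qed.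

Lemma mem_loop2 (X : eqType) (I J : finType) P (h : I -> J -> X) x :
  x \in loop2 P h -> exists i j, P i j /\ x = h i j.
Proof.
case/flatten_mapP => i _ /flatten_mapP[j _]; case: ifP => // Pij.
by rewrite inE => /eqP ->; exists i, j.
Qed.

Lemma loop2_mem (X : eqType) (I J : finType) (P : I -> J -> bool)
    (h : I -> J -> X) i j : P i j -> h i j \in loop2 P h.
Proof.
move=> Pij; apply/flatten_mapP; exists i; rewrite ?mem_enum //.
by apply/flatten_mapP; exists j; rewrite ?mem_enum // Pij mem_head.
Qed.

Lemma uniq_flatten (I X : eqType) (r : seq I) (L : I -> seq X) :
  uniq r -> (forall i, i \in r -> uniq (L i)) ->
  (forall i j x, x \in L i -> x \in L j -> i = j) ->
  uniq (flatten (map L r)).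
Proof.
move=> + + key; elim: r => //= i r IH /andP[ir ur] uL.
rewrite cat_uniq uL ?mem_head // IH // => [|j jr]; last by rewrite uL ?inE ?jr ?orbT.
rewrite andbT; apply/hasPn => x /flatten_mapP[j jr xj]; apply/negP => xi.
by rewrite (key _ _ _ xi xj) jr in ir.
Qed.

Lemma uniq_loop1 (X : eqType) (I : finType) (h : I -> X) :
  injective h -> uniq (loop1 h).
Proof.
move=> h_inj; apply: uniq_flatten => [||i j x]; first exact: enum_uniq.
  by [].
by rewrite !inE => /eqP -> /eqP/h_inj.
Qed.

Lemma uniq_loop2 (X : eqType) (I J : finType) P (h : I -> J -> X) :
  (forall i j i' j', h i j = h i' j' -> i = i' /\ j = j') -> uniq (loop2 P h).
Proof.
move=> h_inj; apply: uniq_flatten => [|i _|i j x]; first exact: enum_uniq.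
  apply: uniq_flatten => [|j _|j j' x]; [exact: enum_uniq|by case: ifP|].
  by do 2 case: ifP => // _; rewrite !inE => /eqP -> /eqP/h_inj[].
case/flatten_mapP => k _; case: ifP => // _; rewrite inE => /eqP ->.
case/flatten_mapP => k' _; case: ifP => // _; rewrite inE => /eqP.
by case/h_inj.
Qed.

(** Blocks that carry different tags are disjoint. *)
Lemma uniq_blocks (X : eqType) (tag : X -> nat) (bs : seq (seq X)) :
  all uniq bs -> (forall i, i < size bs -> all (fun x => tag x == i) (nth [::] bs i)) ->
  uniq (flatten bs).
Proof.
move=> /allP ub tb; rewrite -(mkseq_nth [::] bs); apply: uniq_flatten.
- exact: iota_uniq.
- by move=> i; rewrite mem_iota => /= ib; apply/ub/mem_nth.
have tagE i x : x \in nth [::] bs i -> tag x = i.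
  have [ib xi|le] := ltnP i (size bs); last by rewrite nth_default.
  by apply/eqP; apply: (allP (tb i ib)).
by move=> i j x /tagE <- /tagE.
Qed.

(** * Listing the network *)

(** ** Programs *)

(** Cell (i, j) of array 5 records whether input [j] enters component [i]. *)
Definition mark_body : cmd :=
  If (Get 1 (Reg 9) (Reg 10))
     (If (Get 2 (Cst 0) (Reg 9))
         (Put 5 (Pred (Get 2 (Cst 0) (Reg 9))) (Reg 10) (Cst 1)) nop) nop.

Definition mark : cmd := For 9 0 (For 10 1 mark_body).

Definition emit_vertex (k : nat) (e : expr) : cmd :=
  Seq (Put 3 (Reg 3) (Cst 0) (Cst k))
      (Seq (Put 3 (Reg 3) (Cst 1) e) (SetReg 3 (Succ (Reg 3)))).

Definition list_vertices : cmd :=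
  Seq (emit_vertex 0 (Cst 0)) (Seq (emit_vertex 1 (Cst 0))
 (Seq (For 9 2 (emit_vertex 2 (Reg 9))) (Seq (For 9 0 (emit_vertex 3 (Reg 9)))
 (Seq (For 9 0 (emit_vertex 4 (Reg 9))) (Seq (For 9 1 (emit_vertex 5 (Reg 9)))
      (For 9 1 (emit_vertex 6 (Reg 9)))))))).

Definition emit_cost (cost : option expr) : cmd :=
  if cost is Some e then MoveCost 1 (Reg 4) 0 e else ZeroCost 1 (Reg 4).

Definition emit_edge k1 e1 k2 e2 cap cost : cmd :=
  Seq (Put 4 (Reg 4) (Cst 0) (Cst k1)) (Seq (Put 4 (Reg 4) (Cst 1) e1)
 (Seq (Put 4 (Reg 4) (Cst 2) (Cst k2)) (Seq (Put 4 (Reg 4) (Cst 3) e2)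
 (Seq (Put 4 (Reg 4) (Cst 4) cap) (Seq (emit_cost cost)
      (SetReg 4 (Succ (Reg 4)))))))).

Definition source_scc := emit_edge 0 (Cst 0) 2 (Reg 9) (Cst 1) None.
Definition source_xp := emit_edge 0 (Cst 0) 3 (Reg 9) (Cst 1) None.
Definition scc_up := If (Get 5 (Reg 9) (Reg 10))
  (emit_edge 2 (Reg 9) 6 (Reg 10) (Cst 1) None) nop.
Definition xp_x := If (Get 0 (Reg 9) (Reg 10))
  (emit_edge 3 (Reg 9) 4 (Reg 10) (Cst 1) None) nop.
Definition xp_u := If (Get 1 (Reg 9) (Reg 10))
  (emit_edge 3 (Reg 9) 5 (Reg 10) (Cst 1) None) nop.
Definition u_up := emit_edge 5 (Reg 9) 6 (Reg 9) (Cst 1) None.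
Definition up_sink := emit_edge 6 (Reg 9) 1 (Cst 0) (Succ (Reg 0)) (Some (Reg 9)).
Definition x_sink := emit_edge 4 (Reg 9) 1 (Cst 0) (Cst 1) None.

Definition list_edges : cmd :=
  Seq (For 9 2 source_scc) (Seq (For 9 0 source_xp)
 (Seq (For 9 2 (For 10 1 scc_up)) (Seq (For 9 0 (For 10 0 xp_x))
 (Seq (For 9 0 (For 10 1 xp_u)) (Seq (For 9 1 u_up)
 (Seq (For 9 1 up_sink) (For 9 0 x_sink))))))).

Definition build_network : cmd :=
  Seq find_roots (Seq mark (Seq list_vertices list_edges)).

(** ** Their running times *)

Definition mark_time n m : nat := for_time n (for_time m (time mark_body)).

Definition list_vertices_time n m : nat :=
  let t := time (emit_vertex 0 (Reg 9)) in
  t + (t + (for_time n t + (for_time n t + (for_time n t +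
    (for_time m t + for_time m t))))).

Definition list_edges_time n m : nat :=
  for_time n (time source_scc) + (for_time n (time source_xp) +
  (for_time n (for_time m (time scc_up)) + (for_time n (for_time n (time xp_x)) +
  (for_time n (for_time m (time xp_u)) + (for_time m (time u_up) +
  (for_time m (time up_sink) + for_time n (time x_sink))))))).

Definition build_time n m : nat :=
  find_roots_time n + (mark_time n m +
    (list_vertices_time n m + list_edges_time n m)).

(** The bound on [m] is part of these notions, so that a product of two linear
    running times is quadratic in [n] alone. *)
Definition linear (f : nat -> nat -> nat) : Prop :=
  forall K, exists C, forall n m, 0 < n -> m <= K * n -> f n m <= C * n.

Definition quadratic (f : nat -> nat -> nat) : Prop :=
  forall K, exists C, forall n m, 0 < n -> m <= K * n -> f n m <= C * n ^ 2.

Lemma linear_const c : linear (fun _ _ => c).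
Proof. by move=> K; exists c => n m n0 _; rewrite leq_pmulr. Qed.

Lemma linear_n : linear (fun n _ => n).
Proof. by move=> K; exists 1 => n m _ _; rewrite mul1n. Qed.

Lemma linear_m : linear (fun _ m => m).
Proof. by move=> K; exists K. Qed.

Lemma linear_add f g : linear f -> linear g -> linear (fun n m => f n m + g n m).
Proof.
move=> hf hg K; have [C1 h1] := hf K; have [C2 h2] := hg K.
by exists (C1 + C2) => n m n0 le; rewrite mulnDl leq_add ?h1 ?h2.
Qed.

Lemma linear_for f c : linear f -> linear (fun n m => for_time (f n m) c).
Proof.
move=> hf K; have [C h] := hf K; exists (6 + C * (c + 7)) => n m n0 le.
have := leq_mul (h n m n0 le) (leqnn (c + 7)).
rewrite /for_time mulnDl mulnAC; lia.
Qed.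

Lemma quadratic_linear f : linear f -> quadratic f.
Proof.
move=> hf K; have [C h] := hf K; exists C => n m n0 le.
by rewrite (leq_trans (h n m n0 le)) // leq_mul2l leq_pmulr ?orbT.
Qed.

Lemma quadratic_add f g :
  quadratic f -> quadratic g -> quadratic (fun n m => f n m + g n m).
Proof.
move=> hf hg K; have [C1 h1] := hf K; have [C2 h2] := hg K.
by exists (C1 + C2) => n m n0 le; rewrite mulnDl leq_add ?h1 ?h2.
Qed.

Lemma quadratic_mul f g :
  linear f -> linear g -> quadratic (fun n m => f n m * g n m).
Proof.
move=> hf hg K; have [C1 h1] := hf K; have [C2 h2] := hg K.
by exists (C1 * C2) => n m n0 le; rewrite mulnACA leq_mul ?h1 ?h2.
Qed.

Lemma quadratic_for f g : linear f -> linear g ->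
  quadratic (fun n m => for_time (f n m) (g n m)).
Proof.
move=> hf hg; apply: quadratic_add.
  exact/quadratic_linear/linear_const.
apply: quadratic_add; last exact/quadratic_linear/linear_const.
by apply: quadratic_mul => //; apply: linear_add => //; apply: linear_const.
Qed.

Lemma maxn_linear f c : linear f -> linear (fun n m => maxn (f n m) c).
Proof.
move=> hf K; have [C h] := hf K; exists (C + c) => n m n0 le.
rewrite geq_max mulnDl (leq_trans (h n m n0 le)) ?leq_addr //=.
by rewrite (leq_trans _ (leq_addl _ _)) // leq_pmulr.
Qed.

Lemma quadratic_stage forward : quadratic (fun n _ => stage_time n forward).
Proof.
apply: quadratic_add.
  exact/quadratic_linear/linear_for/linear_n.
apply: quadratic_add; first exact/quadratic_linear/linear_const.
do 3!(apply: quadratic_add; first exact/quadratic_linear/linear_const).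
apply: quadratic_add; last exact/quadratic_linear/linear_const.
apply: quadratic_mul; first exact: linear_add linear_n linear_n.
apply: linear_add (linear_const _) _; apply: linear_add (linear_const _) _.
apply: maxn_linear; apply: linear_add (linear_const _) _.
exact: linear_for linear_n.
Qed.

Lemma quadratic_build : quadratic build_time.
Proof.
have const c := quadratic_linear (linear_const c).
have forn c := quadratic_linear (linear_for c linear_n).
have form c := quadratic_linear (linear_for c linear_m).
have fornm c := quadratic_for linear_n (linear_for c linear_m).
have fornn c := quadratic_for linear_n (linear_for c linear_n).
apply: quadratic_add.
  apply: quadratic_add; first exact: quadratic_add.
  do 2!apply: quadratic_add (quadratic_stage _) _.
  exact: quadratic_add (quadratic_stage _) (const 2).
apply: quadratic_add; first exact: fornm.
apply: quadratic_add.
  do 2!(apply: quadratic_add; first exact: const).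
  do 3!(apply: quadratic_add; first exact: forn).
  by apply: quadratic_add; apply: form.
apply: quadratic_add; first exact: forn.
apply: quadratic_add; first exact: forn.
apply: quadratic_add; first exact: fornm.
apply: quadratic_add; first exact: fornn.
apply: quadratic_add; first exact: fornm.
apply: quadratic_add; first exact: form.
apply: quadratic_add; first exact: form.
exact: forn.
Qed.

(** ** What the programs list *)

Section Network.
Variables (R : realType) (n m : nat) (A : 'M[bool]_n) (B : 'M[bool]_(n, m)).
Variables (pu : 'I_m -> R) (num : ntl_scc A -> 'I_(ntl_count A)).
Hypothesis numK : cancel (@scc_at n A) num.
Implicit Types (s : state R).

(** The data that the listing programs read. *)
Record located s : Prop := Located {
  loc_n : reg s 0 = n;
  loc_m : reg s 1 = m;
  loc_q : reg s 2 = ntl_count A;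
  loc_A : forall i j, arr s 0 i j = bool_cell A i j;
  loc_B : forall i j, arr s 1 i j = bool_cell B i j;
  loc_label : forall w : 'I_n, arr s 2 0 w = reach_label A false (ntl_roots A) w;
  loc_cost : forall j : 'I_m, cst s 0 j = pu j }.

Definition enters (i : 'I_(ntl_count A)) (j : 'I_m) : bool :=
  [exists r in val (scc_at i), B r j].

Definition marked s : Prop :=
  forall (i : 'I_(ntl_count A)) (j : 'I_m), (arr s 5 i j != 0) = enters i j.

Lemma located_stable c :
  ~~ [|| writes_reg 0 c, writes_reg 1 c, writes_reg 2 c, writes_arr 0 c,
         writes_arr 1 c, writes_arr 2 c | writes_cst 0 c] ->
  stable located c.
Proof.
rewrite !negb_or => /and5P[r0 r1 r2 a0 /and3P[a1 a2 k0]].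
move=> s s' [e0 e1 e2 eA eB el ec] [r a k]; split.
- by rewrite r.
- by rewrite r.
- by rewrite r.
- by move=> i j; rewrite a.
- by move=> i j; rewrite a.
- by move=> w; rewrite a.
- by move=> j; rewrite k.
Qed.

Lemma label_scc (r : 'I_n) (i : 'I_(ntl_count A)) :
  (reach_label A false (ntl_roots A) r == i.+1) = (r \in val (scc_at i)).
Proof.
apply/idP/idP => [/eqP E|ri]; last by apply/eqP; apply: (root_label ri).
have [/existsP[j rj]|] := boolP [exists j : 'I_(ntl_count A), r \in scc_of A (root_of j)].
  by move: E; rewrite (root_label rj) => -[/val_inj <-].
rewrite negb_exists => /forallP/no_root_label E'.
by rewrite E' in E.
Qed.

(** The pairs satisfying [before] are those already treated by the two loops. *)
Definition mark_inv (before : 'I_n -> 'I_m -> bool) s : Prop :=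
  located s /\ forall (i : 'I_(ntl_count A)) (j : 'I_m),
    (arr s 5 i j != 0) =
      [exists r, [&& before r j, r \in val (scc_at i) & B r j]].

Lemma mark_body_runs before s (r : 'I_n) (j : 'I_m) :
  mark_inv before s -> reg s 9 = r -> reg s 10 = j ->
  runs s mark_body (time mark_body)
    (mark_inv (fun r' j' => before r' j' || (r' == r) && (j' == j))).
Proof.
move=> [loc inv] s9 s10; have [e0 e1 e2 eA eB el ec] := loc.
have split_ex (i : 'I_(ntl_count A)) (j' : 'I_m) :
    [exists r', [&& before r' j' || (r' == r) && (j' == j),
       r' \in val (scc_at i) & B r' j']] =
    [exists r', [&& before r' j', r' \in val (scc_at i) & B r' j']] ||
    [&& j' == j, r \in val (scc_at i) & B r j'].
  apply/existsP/orP => [[r' /andP[/orP[b|/andP[/eqP -> ->]] h]]|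
    [/existsP[r' /andP[b h]]|/andP[jj h]]].
  - by left; apply/existsP; exists r'; rewrite b.
  - by right.
  - by exists r'; rewrite b.
  - by exists r; rewrite eqxx jj orbT.
apply: wp_runs => /=; rewrite s9 s10 eB bool_cellE el.
have skip : (forall i : 'I_(ntl_count A), B r j -> r \in val (scc_at i) = false) ->
    mark_inv (fun r' j' => before r' j' || (r' == r) && (j' == j))
      (set_reg s 31 0).
  move=> no; split; first by split.
  move=> i j' /=; rewrite split_ex -inv; case: (j' =P j) => [->|_]; last by rewrite orbF.
  by case rj: (B r j); rewrite ?andbF ?orbF // no // orbF.
split=> [|/eqP]; rewrite eqb0 ?negbK => rj; last first.
  by apply: skip => i; rewrite (negPf rj).
have [/existsP[i ri]|] :=
  boolP [exists i : 'I_(ntl_count A), r \in scc_of A (root_of i)]; last first.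
  rewrite negb_exists => /forallP out; rewrite no_root_label //; split=> // _.
  by apply: skip => i _; apply: negbTE (out i).
rewrite (root_label ri) /=; split=> // _; split; first by split.
move=> i' j' /=; rewrite split_ex -inv.
have -> : (r \in scc_of A (root_of i')) = (i' == i).
  by rewrite -[LHS]/(r \in val (scc_at i')) -label_scc (root_label ri) eqSS eq_sym.
rewrite -!val_eqE /=; case: (_ =P i :> nat) => [ii|_] /=; last by rewrite andbF orbF.
case: (_ =P j :> nat) => [jj|_]; rewrite ?orbF //=.
have -> : j' = j by apply: val_inj.
by rewrite rj orbT.
Qed.

Lemma mark_inv_eq before before' s :
  before =2 before' -> mark_inv before s -> mark_inv before' s.
Proof.
move=> E [loc inv]; split=> // i j; rewrite inv.
by apply: eq_existsb => r; rewrite E.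
Qed.

Lemma mark_inv_set_reg before s x v :
  2 < x -> mark_inv before s -> mark_inv before (set_reg s x v).
Proof.
move=> x2 [loc inv]; split=> //.
by apply: (@located_stable (SetReg x (Cst v))) loc _;
  [case: x x2 => [|[|[]]] | exact: exec_same (ExecSetReg _ _ _)].
Qed.

Lemma mark_runs s : located s -> (forall i j, arr s 5 i j = 0) ->
  runs s mark (mark_time n m) (fun s' => located s' /\ marked s').
Proof.
move=> loc zero.
pose I k s1 := mark_inv (fun r _ => r < k) s1.
apply: runs_le (@runs_for _ 9 0 _ _ n I _ _ _ _ _ _ _) (leqnn _) _ => //=.
- exact: loc_n.
- apply: mark_inv_set_reg => //; split=> // i j; rewrite zero eqxx.
  by apply/esym/existsP => -[].
- move=> k s1 kn inv1 s1k; pose r := Ordinal kn.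
  pose J l s2 := mark_inv (fun r' (j' : 'I_m) => (r' < k) || (r' == r) && (j' < l)) s2
    /\ reg s2 9 = r.
  apply: runs_le (@runs_for _ 10 1 mark_body _ m J _ _ _ _ _ _ _) (leqnn _) _ => //=.
  + by case: inv1 => /loc_m.
  + split=> //; apply: mark_inv_set_reg => //; apply: mark_inv_eq inv1 => r' j'.
    by rewrite andbF orbF.
  + move=> l s2 lm [inv2 s2r] s2l.
    apply: runs_le (runs_same (@mark_body_runs _ s2 r (Ordinal lm) inv2 s2r s2l))
      (leqnn _) _ => s3 [inv3 [sm _ _]].
    split; last by rewrite /= sm.
    apply: mark_inv_set_reg => //; apply: mark_inv_eq inv3 => r' j'.
    rewrite -orbA -andb_orr; congr (_ || (_ && _)).
    by rewrite ltnS [RHS]leq_eqVlt -val_eqE /= orbC.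
  move=> s2 [inv2 _]; apply: mark_inv_set_reg => //; apply: mark_inv_eq inv2 => r' j'.
  by rewrite ltn_ord andbT ltnS [RHS]leq_eqVlt -val_eqE /= orbC.
move=> s1 [loc1 inv1]; split=> // i j; rewrite inv1 /enters.
by apply: eq_existsb => r; rewrite ltn_ord.
Qed.

Definition listed_vertices s : seq (nat * nat) :=
  [seq (arr s 3 k 0, arr s 3 k 1) | k <- iota 0 (reg s 3)].

Definition listed_edges s : seq ((nat * nat) * (nat * nat) * nat * R) :=
  [seq ((arr s 4 k 0, arr s 4 k 1), (arr s 4 k 2, arr s 4 k 3), arr s 4 k 4,
        cst s 1 k) | k <- iota 0 (reg s 4)].

Definition edge_code (p : vertex m A * vertex m A) :=
  (vertex_code num p.1, vertex_code num p.2,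
   if p is (Up _, Sink) then n.+1 else 1,
   if p is (Up j, Sink) then pu j else 0%R).

(** Expressions that the array writes of an emission leave unchanged. *)
Fixpoint pure e : bool :=
  match e with
  | Cst _ | Reg _ => true
  | Succ e | Pred e => pure e
  | _ => false
  end.

Lemma eval_pure s s' e : pure e -> reg s = reg s' -> eval s e = eval s' e.
Proof. by elim: e => //= [x|e IH|e IH] h E; rewrite ?E // IH. Qed.

Lemma emit_vertex_emits (P : state R -> Prop) k e (v : vertex m A) : pure e ->
  (forall s, P s -> (k, eval s e) = vertex_code num v) ->
  emits listed_vertices (vertex_code num) P (emit_vertex k e)
    (time (emit_vertex k e)) [:: v].
Proof.
move=> pe vE s Ps; apply: wp_runs; rewrite /= /listed_vertices.
set s' := set_reg _ _ _; have -> : reg s' 3 = reg s 3 + 1 by rewrite addn1.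
rewrite -(vE s Ps) iotaD map_cat; congr (_ ++ _).
  apply/eq_in_map => i; rewrite mem_iota => /= ik.
  by rewrite (ltn_eqF ik).
by rewrite /= !eqxx /= (@eval_pure _ s).
Qed.

Definition emitted_cost cost s : R :=
  if cost is Some e then cst s 0 (eval s e) else 0%R.

Lemma emit_edge_emits (P : state R -> Prop) k1 e1 k2 e2 cap cost p :
  pure e1 && pure e2 && pure cap && (if cost is Some e then pure e else true) ->
  (forall s, P s ->
    ((k1, eval s e1), (k2, eval s e2), eval s cap, emitted_cost cost s) =
    edge_code p) ->
  emits listed_edges edge_code P (emit_edge k1 e1 k2 e2 cap cost)
    (time (emit_edge k1 e1 k2 e2 cap cost)) [:: p].
Proof.
case/andP=> /andP[/andP[p1 p2] p3] p4 pE s Ps; apply: wp_runs.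
rewrite -[map _ _]/[:: edge_code p] -(pE s Ps).
case: cost p4 {pE} => [e|] pe; rewrite /= /listed_edges;
  (set s' := set_reg _ _ _; have -> : reg s' 4 = reg s 4 + 1 by rewrite addn1);
  rewrite iotaD map_cat; congr (_ ++ _);
  do ?[by apply/eq_in_map => i; rewrite mem_iota => /= ik; rewrite (ltn_eqF ik)];
  by rewrite /= !eqxx /= !(@eval_pure _ s).
Qed.

Local Notation q := (ntl_count A).

Definition vertex_list : seq (vertex m A) :=
  flatten [:: [:: Source]; [:: Sink]; loop1 (fun i : 'I_q => Scc (scc_at i));
    loop1 (fun k : 'I_n => Xp k); loop1 (fun r : 'I_n => X r);
    loop1 (fun j : 'I_m => U j); loop1 (fun j : 'I_m => Up j)].

Definition edge_list : seq (vertex m A * vertex m A) :=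
  flatten [::
    loop1 (fun i : 'I_q => (Source, Scc (scc_at i)));
    loop1 (fun k : 'I_n => (Source, Xp k));
    loop2 enters (fun i j => (Scc (scc_at i), Up j));
    loop2 (fun k r => A k r) (fun k r => (Xp k, X r));
    loop2 (fun k j => B k j) (fun k j => (Xp k, U j));
    loop1 (fun j : 'I_m => (U j, Up j));
    loop1 (fun j : 'I_m => (Up j, Sink));
    loop1 (fun r : 'I_n => (X r, Sink))].

Lemma listed_vertices_set_reg s x v :
  x != 3 -> listed_vertices (set_reg s x v) = listed_vertices s.
Proof. by move=> x3; rewrite /listed_vertices /= eq_sym (negPf x3). Qed.

Lemma listed_edges_set_reg s x v :
  x != 4 -> listed_edges (set_reg s x v) = listed_edges s.
Proof. by move=> x4; rewrite /listed_edges /= eq_sym (negPf x4). Qed.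

Lemma list_vertices_emits :
  emits listed_vertices (vertex_code num) located list_vertices
    (list_vertices_time n m) vertex_list.
Proof.
rewrite /vertex_list /= cats0 -[Sink :: _]cat1s -[Source :: _]cat1s.
apply: emits_seq; [by apply: emit_vertex_emits | exact: located_stable |].
apply: emits_seq; [by apply: emit_vertex_emits | exact: located_stable |].
have loop x (I : nat) N' (h : 'I_I -> vertex m A) k : I <= N' -> x < 3 ->
    (forall s, located s -> reg s x = I) ->
    (forall i, vertex_code num (h i) = (k, i : nat)) ->
    emits listed_vertices (vertex_code num) located
      (For 9 x (emit_vertex k (Reg 9)))
      (for_time N' (time (emit_vertex 0 (Reg 9)))) (loop1 h).
  move=> le x3 xI hE; apply: (emits_for listed_vertices_set_reg) => //.
  - by case: x x3 {xI} => [|[|[]]].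
  - by case: x x3 {xI} => [|[|[]]].
  - by case: x x3 {xI} => [|[|[]]] //= _; apply: located_stable.
  by move=> i; apply: emit_vertex_emits => // s [_ /= ->].
have q_le := ntl_count_le A.
apply: emits_seq; [|exact: located_stable|].
  by apply: loop => // [s /loc_q|i] //=; rewrite numK.
apply: emits_seq; [|exact: located_stable|].
  by apply: loop => // s /loc_n.
apply: emits_seq; [|exact: located_stable|].
  by apply: loop => // s /loc_n.
apply: emits_seq; [|exact: located_stable|].
  by apply: loop => // s /loc_m.
by apply: loop => // s /loc_m.
Qed.

Definition ready s : Prop := located s /\ marked s.

Lemma ready_stable c :
  ~~ [|| writes_reg 0 c, writes_reg 1 c, writes_reg 2 c, writes_arr 0 c,
         writes_arr 1 c, writes_arr 2 c | writes_cst 0 c] ->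
  ~~ writes_arr 5 c -> stable ready c.
Proof.
move=> wc w5 s s' [loc mk] sm; split; first exact: located_stable wc _ _ loc sm.
by move=> i j; have [_ a _] := sm; rewrite a.
Qed.

Lemma list_edges_emits :
  emits listed_edges edge_code ready list_edges (list_edges_time n m) edge_list.
Proof.
rewrite /edge_list /= cats0.
have loop x (I : nat) N' (h : 'I_I -> vertex m A * vertex m A) k1 e1 k2 e2 cap cost :
    let c := emit_edge k1 e1 k2 e2 cap cost in
    I <= N' -> x < 3 -> (forall s, ready s -> reg s x = I) ->
    pure e1 && pure e2 && pure cap && (if cost is Some e then pure e else true) ->
    (forall s i, ready s -> reg s 9 = i -> forall i' : 'I_I, i' = i :> nat ->
      ((k1, eval s e1), (k2, eval s e2), eval s cap, emitted_cost cost s) =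
      edge_code (h i')) ->
    emits listed_edges edge_code ready (For 9 x c) (for_time N' (time c)) (loop1 h).
  move=> c le x3 xI pe hE; apply: (emits_for listed_edges_set_reg) => //.
  - by case: x x3 {xI} => [|[|[]]].
  - by rewrite /c; case: (cost).
  - by rewrite /c; case: x x3 {xI} => [|[|[]]] //= _; case: (cost).
  - rewrite /c; case: x x3 {xI} => [|[|[]]] //= _; case: (cost) => [e|];
      exact: ready_stable.
  by move=> i; apply: emit_edge_emits => // s [rs s9]; apply: hE rs s9 _ _.
have loop' y x (I J : nat) N' M' (P : 'I_I -> 'I_J -> bool)
    (h : 'I_I -> 'I_J -> vertex m A * vertex m A) a k1 k2 :
    let c := emit_edge k1 (Reg 9) k2 (Reg 10) (Cst 1) None in
    let b := If (Get a (Reg 9) (Reg 10)) c nop in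
    I <= N' -> J <= M' -> x < 3 -> y < 3 ->
    (forall s, ready s -> reg s x = I) -> (forall s, ready s -> reg s y = J) ->
    (forall s (i : 'I_I) (j : 'I_J), ready s -> (arr s a i j != 0) = P i j) ->
    (forall i j, edge_code (h i j) = ((k1, i : nat), (k2, j : nat), 1, 0%R)) ->
    emits listed_edges edge_code ready (For 9 x (For 10 y b))
      (for_time N' (for_time M' (time b))) (loop2 P h).
  move=> c b leI leJ x3 y3 xI yJ aP hE.
  apply: (emits_for listed_edges_set_reg) => //.
  - by case: x x3 {xI} => [|[|[]]].
  - by case: x x3 {xI} => [|[|[]]].
  - by case: x x3 {xI} => [|[|[]]] //= _; apply: ready_stable.
  move=> i; apply: (emits_for listed_edges_set_reg) => //.
  - by case: y y3 {yJ} => [|[|[]]].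
  - by case: y y3 {yJ} => [|[|[]]].
  - by move=> s [/yJ].
  - by apply: stable_reg => //; apply: ready_stable.
  move=> j; apply: (emits_if listed_edges_set_reg) => //.
    by move=> s [[rs s9] s10]; rewrite /= s9 s10 aP.
  apply: emit_edge_emits => // s [[rs s9] s10].
  by rewrite hE /= s9 s10.
have q_le := ntl_count_le A.
have rn s : ready s -> reg s 0 = n by case=> /loc_n.
have rm s : ready s -> reg s 1 = m by case=> /loc_m.
have rq s : ready s -> reg s 2 = q by case=> /loc_q.
apply: emits_seq; [|exact: ready_stable|].
  by apply: loop => // s i rs s9 i' ii; rewrite /edge_code /= numK s9 ii.
apply: emits_seq; [|exact: ready_stable|].
  by apply: loop => // s i rs s9 i' ii; rewrite /edge_code /= s9 ii.
apply: emits_seq; [|exact: ready_stable|].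
  apply: loop' => // [s i j [_ mk]|i j]; first exact: mk.
  by rewrite /edge_code /= numK.
apply: emits_seq; [|exact: ready_stable|].
  by apply: loop' => // s i j [/loc_A -> _]; rewrite bool_cellE eqb0 negbK.
apply: emits_seq; [|exact: ready_stable|].
  by apply: loop' => // s i j [/loc_B -> _]; rewrite bool_cellE eqb0 negbK.
apply: emits_seq; [|exact: ready_stable|].
  by apply: loop => // s i rs s9 i' ii; rewrite /edge_code /= s9 ii.
apply: emits_seq; [|exact: ready_stable|].
  apply: loop => // s i rs s9 i' ii; rewrite /edge_code /= s9 ii (rn s rs).
  by case: rs => /loc_cost/(_ i') <- _; rewrite ii.
by apply: loop => // s i rs s9 i' ii; rewrite /edge_code /= s9 ii.
Qed.

(** ** The lists are complete and free of repetitions *)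

Lemma scc_at_num : cancel num (@scc_at n A).
Proof. by apply/bij_can_sym; [apply: scc_at_bij | apply: numK]. Qed.

Lemma vertex_list_perm : perm_eq vertex_list (enum {: vertex m A}).
Proof.
apply: uniq_perm; rewrite ?enum_uniq //.
  apply: (@uniq_blocks _ (fun v => (vertex_code num v).1)).
    have Scc_inj : injective (@Scc n m A) by move=> N N' [].
  rewrite /= !uniq_loop1 //;
    by move=> i j; first [by move/Scc_inj/scc_at_inj | by case].
  case=> [|[|[|[|[|[|[|//]]]]]]] _ //=; apply/allP => x;
    by case/mem_loop1 => i ->.
move=> v; rewrite mem_enum /vertex_list /= !inE !mem_cat.
case: v => [||N|k|r|j|j] //.
- by rewrite -(scc_at_num N) (loop1_mem (fun i => Scc (scc_at i))) !orbT.
- by rewrite (loop1_mem (fun k => Xp k)) !orbT.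
- by rewrite (loop1_mem (fun r => X r)) !orbT.
- by rewrite (loop1_mem (fun j => U j)) !orbT.
- by rewrite (loop1_mem (fun j => Up j)) !orbT.
Qed.

Lemma edge_list_uniq : uniq edge_list.
Proof.
have Scc_inj : injective (@Scc n m A) by move=> N N' [].
apply: (@uniq_blocks _ (fun p => match p with
  | (Source, Scc _) => 0 | (Source, _) => 1 | (Scc _, _) => 2
  | (Xp _, X _) => 3 | (Xp _, _) => 4 | (U _, _) => 5 | (Up _, _) => 6
  | _ => 7 end)).
  rewrite /= !uniq_loop1 ?uniq_loop2 //; (move=> i j; first
    [ by move/(congr1 snd)/Scc_inj/scc_at_inj | by case
    | by move=> i' j' E; have /Scc_inj/scc_at_inj -> := congr1 fst E; case: E
    | by move=> i' j' [-> ->]]).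
case=> [|[|[|[|[|[|[|[|//]]]]]]]] _ /=; apply/allP => p;
  by [case/mem_loop1 => i -> | case/mem_loop2 => i [j [_ ->]]].
Qed.

Lemma mem_edge_list p : (p \in edge_list) = is_edge B p.
Proof.
have [mem|] := boolP (is_edge B p).
  rewrite /edge_list /= !mem_cat.
  case: p mem => -[||N|k|r|j|j] [||N'|k'|r'|j'|j'] //= mem.
  - by rewrite -(scc_at_num N') (loop1_mem (fun i => (Source, Scc (scc_at i)))).
  - by rewrite (loop1_mem (fun k => (Source, Xp k))) !orbT.
  - rewrite -(scc_at_num N) in mem *.
    by rewrite (@loop2_mem _ _ _ _ (fun i j => (Scc (scc_at i), Up j))) // !orbT.
  - by rewrite (@loop2_mem _ _ _ _ (fun k r => (Xp k, X r))) // !orbT.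
  - by rewrite (@loop2_mem _ _ _ _ (fun k j => (Xp k, U j))) // !orbT.
  - by rewrite (loop1_mem (fun r => (X r, Sink))) !orbT.
  - by rewrite -(eqP mem) (loop1_mem (fun j => (U j, Up j))) !orbT.
  - by rewrite (loop1_mem (fun j => (Up j, Sink))) !orbT.
apply: contraNF; rewrite /edge_list /= !mem_cat.
do !case/orP; rewrite ?in_nil //.
all: try by case/mem_loop1 => i -> /=.
all: by case/mem_loop2 => i [j [ij ->]].
Qed.
End Network.

Lemma edge_enum_perm (n m : nat) (A : 'M[bool]_n) (B : 'M[bool]_(n, m))
    (s : seq (vertex m A * vertex m A)) :
  uniq s -> (forall p, (p \in s) = is_edge B p) ->
  perm_eq s [seq val e | e : edge A B].
Proof.
move=> us sE; apply: uniq_perm => // [|p].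
  by rewrite map_inj_uniq ?enum_uniq //; apply: val_inj.
rewrite sE; apply/idP/mapP => [pe|[e _ ->]]; last exact: valP.
by exists (exist _ p pe); rewrite ?mem_enum.
Qed.

Lemma build_network_runs (R : realType) n m (A : 'M[bool]_n) (B : 'M[bool]_(n, m))
    (pu : 'I_m -> R) :
  runs (input_state A B pu) build_network (build_time n m) (outputs_network A B pu).
Proof.
have [num numK Knum] := scc_at_bij A.
set s0 := input_state A B pu; apply: runs_seq.
apply: runs_le (runs_same (find_roots_runs A B pu)) (leqnn _) _.
move=> s1 [[s1q s1lab] [r1 a1 k1]].
have loc1 : located A B pu s1.
  split=> //; rewrite ?r1 //.
  - by move=> i j; rewrite a1.
  - by move=> i j; rewrite a1.
  - by move=> j; rewrite k1 //= /cost_cell valK.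
apply: runs_seq.
have zero1 i j : arr s1 5 i j = 0 by rewrite a1.
apply: runs_le (runs_same (mark_runs loc1 zero1)) (leqnn _) _.
move=> s2 [ready2 [r2 a2 k2]]; apply: runs_seq.
apply: runs_le (runs_same (list_vertices_emits numK (proj1 ready2))) (leqnn _) _.
move=> s3 [vert3 same3].
have ready3 : ready A B pu s3 by apply: ready_stable ready2 same3.
have [r3 a3 k3] := same3.
apply: runs_le (runs_same (list_edges_emits numK ready3)) (leqnn _) _.
move=> s4 [edge4 same4].
have [loc4 _] : ready A B pu s4 by apply: ready_stable ready3 same4.
have [r4 a4 k4] := same4.
have vert4 : listed_vertices s4 = map (vertex_code num) (vertex_list m A).
  rewrite /listed_vertices r4 //.
  rewrite (eq_map (g := fun k => (arr s3 3 k 0, arr s3 3 k 1))); last first.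
    by move=> k; rewrite !a4.
  rewrite -/(listed_vertices s3) vert3 /listed_vertices r2 // r1 //=.
have {}edge4 : listed_edges s4 = map (edge_code pu num) (edge_list A B).
  by rewrite edge4 /listed_edges r3 // r2 // r1.
exists num; split.
- by exists (@scc_at n A).
- exact: loc_q loc4.
- move=> r; have labE := loc_label loc4 r; split=> [N rN|out].
    rewrite labE; apply/eqP; rewrite label_scc.
    by rewrite Knum.
  by rewrite labE no_root_label // => i; apply: (out (scc_at i)).
- rewrite -/(listed_vertices s4) vert4 /image_mem perm_map //.
  exact: vertex_list_perm numK.
rewrite -/(listed_edges s4) edge4.
have -> : [seq (vertex_code num (edge_tail e), vertex_code num (edge_head e),
    capacity e, edge_cost pu e) | e : edge A B] =
    map (edge_code pu num) [seq val e | e : edge A B].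
  rewrite /image_mem -map_comp; apply: eq_map => -[[v w] vw] /=.
  rewrite /edge_code /capacity /edge_cost /=.
  by case: v w vw => [||?|?|?|?|?] [||?|?|?|?|?].
apply: perm_map; apply: edge_enum_perm; first exact: edge_list_uniq.
exact: mem_edge_list numK.
Qed.

Theorem network_quadratic (R : realType) : network_constructible_quadratic R.
Proof.
exists build_network => K; have [C bound] := quadratic_build K.
exists C => n m A B pu n0 mK _ _.
have [t [s [ex le out]]] := build_network_runs A B pu.
exists t, s; split=> //; exact: leq_trans le (bound n m n0 mK).
Qed.

Local Open Scope ring_scope.

Theorem theoremV4 (R : realType) :
  network_constructible_quadratic R /\
  forall (n m : nat) (A : 'M[bool]_n) (B : 'M[bool]_(n, m)) (pu : 'I_m -> R),
    structurally_controllable R A B ->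
    (forall j, 0 <= pu j) ->
    (forall f : edge A B -> R,
       MCFF_optimal pu (ntl_count A + n) f ->
       minCCIS_optimal A B pu (selected_inputs f)) /\
    (exists v : R,
       minCCIS_value A B pu v /\ MCFF_value A B pu (ntl_count A + n) v).
Proof. by split; [apply: network_quadratic | move=> n m A B pu; apply: MCFF_minCCIS]. Qed.
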